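(* Let $s>1$, $1<p<\infty$, $\lambda\in[n-1,n)$ and $\delta,\tau\in(0,1)$, and suppose \[ s<\frac{n+1-\lambda}{1-\delta},\qquad p>\frac{s(n-1)-\lambda+1}{n-s(1-\delta)-\lambda+1}. \] Let $G$ be an $s$-John domain in $\mathbb{R}^n$, $n\ge2$, with $\dim_{\mathcal M}(\partial G)\le\lambda$. Then there is $c<\infty$ such that for all $u\in L^p(G)$ \[ \int_G|u(x)-u_G|\,dx\le c\left(\int_G\int_{G\cap B^n(x,\tau\operatorname{dist}(x,\partial G))}\frac{|u(x)-u(y)|^p}{|x-y|^{n+\delta p}}\,dy\,dx\right)^{1/p}. \]
   Context: A bounded domain $G\subset\mathbb{R}^n$ is an $s$-John domain ($s\ge1$) if there are $x_0\in G$ and $c>0$ such that every $x\in G$ can be joined to $x_0$ by a rectifiable arc-length parametrized curve $\gamma:[0,l]\to G$ with $\gamma(0)=x$, $\gamma(l)=x_0$, $l\le c$, and $\operatorname{dist}(\gamma(t),\partial G)\ge t^s/c$ for $t\in[0,l]$. The upper Minkowski dimension of $E\subset\mathbb{R}^n$ is $\dim_{\mathcal M}(E)=\sup\{\lambda\ge0:\limsup_{r\to0+}|E+B^n(0,r)|\,r^{\lambda-n}=\infty\}$. $u_G$ is the mean of $u$ over $G$. *)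

(* Defs.v *)
From HB Require Import structures.
From mathcomp Require Import all_boot all_order all_algebra.
From mathcomp Require Import all_classical all_reals all_analysis.
Set Implicit Arguments. Unset Strict Implicit. Unset Printing Implicit Defensive.
Import Order.TTheory GRing.Theory Num.Theory.
Import numFieldNormedType.Exports.
Local Open Scope classical_set_scope.
Local Open Scope ring_scope.

Section Rn.
Variable R : realType.

(** Euclidean norm on R^n = 'rV[R]_n (the library norm on matrices is the
    max-norm, so we define the Euclidean one explicitly). *)
Definition enorm n (v : 'rV[R]_n) : R := Num.sqrt (\sum_(i < n) v ord0 i ^+ 2).

Definition eball n (x : 'rV[R]_n) (r : R) : set 'rV[R]_n :=
  [set y | enorm (y - x) < r].

Definition rcons0 m (x : R) (v : 'rV[R]_m) : 'rV[R]_m.+1 :=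
  \row_(i < m.+1) oapp (fun j => v ord0 j) x (unlift ord0 i).

(** n-dimensional Lebesgue integral of an extended-real function on R^n,
    as the iterated one-dimensional Lebesgue integral (Tonelli). *)
Fixpoint iint (n : nat) : ('rV[R]_n -> \bar R) -> \bar R :=
  match n return ('rV[R]_n -> \bar R) -> \bar R with
  | 0 => fun f => f 0
  | m.+1 => fun f =>
      (\int[@lebesgue_measure R]_x iint (fun v => f (rcons0 x v)))%E
  end.

Definition vol n (A : set 'rV[R]_n) : \bar R := iint (fun x => (\1_A x)%:E).

Definition iintR n (f : 'rV[R]_n -> R) : R :=
  fine (iint (fun x => (Num.max (f x) 0)%:E)) -
  fine (iint (fun x => (Num.max (- f x) 0)%:E)).

Definition mean n (G : set 'rV[R]_n) (u : 'rV[R]_n -> R) : R :=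
  iintR (fun x => \1_G x * u x) / fine (vol G).

Definition borelRn n : set (set 'rV[R]_n) :=
  smallest (sigma_algebra setT) [set A : set 'rV[R]_n | open A].

Definition lnull n (N : set 'rV[R]_n) :=
  exists B, borelRn B /\ N `<=` B /\ vol B = 0%E.

Definition lmeasurable n (A : set 'rV[R]_n) :=
  exists B, borelRn B /\ lnull ((A `\` B) `|` (B `\` A)).

Definition lmeasurable_fun_on n (G : set 'rV[R]_n) (u : 'rV[R]_n -> R) :=
  forall O : set R, open O -> lmeasurable (G `&` u @^-1` O).

Definition Lp n (p : R) (G : set 'rV[R]_n) (u : 'rV[R]_n -> R) :=
  lmeasurable_fun_on G u /\
  (iint (fun x => (\1_G x * (`|u x| `^ p))%:E) < +oo)%E.

Definition boundary n (G : set 'rV[R]_n) : set 'rV[R]_n :=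
  closure G `\` interior G.

Definition dist_to n (x : 'rV[R]_n) (E : set 'rV[R]_n) : R :=
  inf [set enorm (x - y) | y in E].

Definition curve_length n (g : R -> 'rV[R]_n) (a b : R) : \bar R :=
  ereal_sup [set e | exists (k : nat) (t : nat -> R),
    [/\ t 0%N = a, t k = b, (forall i, (i < k)%N -> t i <= t i.+1) &
        e = (\sum_(i < k) enorm (g (t i.+1) - g (t i)))%:E]].

Definition arclength_param n (g : R -> 'rV[R]_n) (l : R) :=
  forall a b, 0 <= a -> a <= b -> b <= l -> curve_length g a b = (b - a)%:E.

Definition domain n (G : set 'rV[R]_n) := [/\ open G, connected G & G !=set0].

Definition bounded_set n (G : set 'rV[R]_n) := exists M : R, forall x, G x -> enorm x <= M.

Definition john_domain n (s : R) (G : set 'rV[R]_n) :=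
  [/\ domain G, bounded_set G &
  exists (x0 : 'rV[R]_n) (c : R), [/\ G x0, 0 < c &
    forall x, G x -> exists (l : R) (g : R -> 'rV[R]_n),
      [/\ 0 <= l /\ l <= c, g 0 = x, g l = x0, arclength_param g l &
        forall t, 0 <= t -> t <= l ->
          G (g t) /\ t `^ s / c <= dist_to (g t) (boundary G)]]].

Definition rneigh n (E : set 'rV[R]_n) (r : R) : set 'rV[R]_n :=
  [set x | exists2 e, E e & enorm (x - e) < r].

Definition dimM n (E : set 'rV[R]_n) : \bar R :=
  ereal_sup [set l%:E | l in [set l : R | 0 <= l /\
    limf_esup (fun r : R => (vol (rneigh E r) * (r `^ (l - n%:R))%:E)%E) (0^'+)
      = +oo%E]].

End Rn.

(* Main.v *)
Require Import Defs.
From HB Require Import structures.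
From mathcomp Require Import all_boot all_order all_algebra.
From mathcomp Require Import all_classical all_reals all_analysis.
From mathcomp Require Import measurable_realfun zify lra ring.
Import Order.TTheory GRing.Theory Num.Theory.
Import numFieldNormedType.Exports.
Local Open Scope classical_set_scope.
Local Open Scope ring_scope.
Set Implicit Arguments. Unset Strict Implicit. Unset Printing Implicit Defensive.

(** Cover G by the maximal dyadic cubes Q whose side is at most a small multiple of the distance d
    to the boundary. Following a John curve from Q with steps tau d / 8 and deleting loops gives a
    chain of distinct cubes from Q to a fixed cube Q_0, consecutive cubes R, R' being so close that
    R' lies in B(x, tau d(x)) for all x in R. By Jensen's inequality
    |u_R - u_R'| <= C (side(R)^(delta p - n) e_R)^(1/p), where e_R is the part of the double
    integral with x in R, so
    int_G |u - u_{Q_0}| <= C sum_Q |Q| sum_{R in chain(Q)} (side(R)^(delta p - n) e_R)^(1/p).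
    By the s-John condition a chain through a cube R of side 2^-j starts within C h of R, with
    h = 2^(-j/s), and contains at most C h 2^j cubes of this side. So the union of the Q whose chain
    meets R has measure at most C h^n, and the union of the Q whose chain meets level j lies in the
    C h-neighbourhood of the boundary, which has measure at most C h^(n - lam') for some lam' > lam.
    Young's inequality with weight h^n on e_R then bounds the sum by a geometric series in j, which
    converges exactly under the assumption on p.

    As [iint] iterates the integral of a nonnegative function, which is a supremum over simple
    functions, it is monotone and superadditive without measurability; this suffices for the lower
    bounds on the double integral, so no joint measurability is ever needed. *)

(** * Lebesgue measure and iterated lower integrals *)
Section lower_integral.
Local Open Scope ereal_scope.
Context d (T : measurableType d) (R : realType).
Variable mu : {measure set T -> \bar R}.
Import HBNNSimple.

(* No measurability: the integral of a nonnegative function is by definition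
   the supremum of the integrals of the simple functions below it. *)
Lemma lower_integral_le (f g : T -> \bar R) :
  (forall x, 0 <= f x) -> (forall x, f x <= g x) ->
  \int[mu]_x f x <= \int[mu]_x g x.
Proof.
move=> f0 fg; rewrite !ge0_integralTE//; last by move=> x; exact: le_trans (fg x).
apply: ereal_sup_le => _ [h /= hf <-].
by exists h => // x; exact: le_trans (fg x).
Qed.

Let add_slack (a b x y : \bar R) (e : R) :
  a + (- (e / 2))%:E < x -> b + (- (e / 2))%:E < y -> a + b <= x + y + e%:E.
Proof.
rewrite !EFinN !lteBlDr// => /ltW ax /ltW bY.
have -> : e%:E = (e / 2)%:E + (e / 2)%:E by rewrite -EFinD; congr EFin; lra.
by rewrite addeACA; exact: leeD.
Qed.

(** Near-optimal simple functions below [f] and below [g] add up to a simple function below [f + g].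
    An infinite right-hand side is split off first, so that both integrals on the left are finite
    and can be approached within [e / 2]. *)
Lemma lower_integralD (f g : T -> \bar R) :
  (forall x, 0 <= f x) -> (forall x, 0 <= g x) ->
  \int[mu]_x f x + \int[mu]_x g x <= \int[mu]_x (f x + g x).
Proof.
move=> f0 g0; have fg0 x : 0 <= f x + g x by rewrite adde_ge0.
have [->|foo] := eqVneq (\int[mu]_x (f x + g x)) +oo; first exact: leey.
have fle : \int[mu]_x f x <= \int[mu]_x (f x + g x).
  by apply: lower_integral_le => // x; rewrite leeDl.
have gle : \int[mu]_x g x <= \int[mu]_x (f x + g x).
  by apply: lower_integral_le => // x; rewrite leeDr.
have ff : \int[mu]_x f x \is a fin_num.
  by rewrite ge0_fin_numE ?integral_ge0// (le_lt_trans fle)// ltey.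
have gf : \int[mu]_x g x \is a fin_num.
  by rewrite ge0_fin_numE ?integral_ge0// (le_lt_trans gle)// ltey.
apply/lee_addgt0Pr => e e0.
have e20 : (0 < e / 2)%R by lra.
have := ff; rewrite {1}ge0_integralTE// => ff'.
have := gf; rewrite {1}ge0_integralTE// => gf'.
have [_ [h /= hf <-] h1] := ub_ereal_sup_adherent e20 ff'.
have [_ [k /= kg <-] k1] := ub_ereal_sup_adherent e20 gf'.
move: h1 k1; rewrite -!ge0_integralTE// => h1 k1.
have hk : sintegral mu h + sintegral mu k <= \int[mu]_x (f x + g x).
  rewrite -sintegralD ge0_integralTE//; apply: ereal_sup_ubound.
  by exists (add_nnsfun h k) => // x /=; rewrite EFinD leeD.
rewrite (le_trans _ (leeD2r e%:E hk))//.
exact: add_slack h1 k1.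
Qed.
End lower_integral.

Section iint_lemmas.
Variable R : realType.
Local Open Scope ereal_scope.

Lemma iint_ge0 n (f : 'rV[R]_n -> \bar R) : (forall x, 0 <= f x) -> 0 <= iint f.
Proof.
elim: n f => [|n ih] f f0 //=.
by apply: integral_ge0 => x _; exact: ih.
Qed.

Lemma le_iint n (f g : 'rV[R]_n -> \bar R) :
  (forall x, 0 <= f x) -> (forall x, f x <= g x) -> iint f <= iint g.
Proof.
elim: n f g => [|n ih] f g f0 fg /=; first exact: fg.
by apply: lower_integral_le => x; [exact: iint_ge0|exact: ih].
Qed.

Lemma le_iintD n (f g : 'rV[R]_n -> \bar R) :
  (forall x, 0 <= f x) -> (forall x, 0 <= g x) ->
  iint f + iint g <= iint (fun x => f x + g x).
Proof.
elim: n f g => [|n ih] f g f0 g0 //=.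
apply: le_trans (lower_integralD _ _ _) _.
- by move=> x; exact: iint_ge0.
- by move=> x; exact: iint_ge0.
apply: lower_integral_le => x; last exact: ih.
by apply: adde_ge0; exact: iint_ge0.
Qed.

Lemma le_iint_sum n (I : Type) (s : seq I) (f : I -> 'rV[R]_n -> \bar R) :
  (forall i x, 0 <= f i x) ->
  \sum_(i <- s) iint (f i) <= iint (fun x => \sum_(i <- s) f i x).
Proof.
move=> f0; elim: s => [|i s ih].
  by rewrite big_nil iint_ge0// => x; rewrite big_nil.
rewrite big_cons (eq_fun (fun x => big_cons _ _ _ _ _ _)).
rewrite (le_trans (leeD2l _ ih))//; apply: le_iintD => // x.
exact: sume_ge0.
Qed.

End iint_lemmas.

(** * Borel sets of R^n and coordinatewise measurability *)

Section rV_measurable.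
Variable R : realType.

(** A copy of the row vectors carrying the sigma-algebra generated by the open sets, which is the
    [borelRn] of the statement. *)
Definition rVb n := g_sigma_algebraType (@open 'rV[R]_n).
HB.instance Definition _ n := Measurable.on (rVb n).

Lemma open_rVb_measurable n (A : set 'rV[R]_n) : open A -> measurable (A : set (rVb n)).
Proof. exact: sub_sigma_algebra. Qed.

Lemma continuous_rVb_measurable n (f : 'rV[R]_n -> R) :
  continuous f -> measurable_fun setT (f : rVb n -> R).
Proof.
move=> cf; apply: (measurability _ (RGenOpens.measurableE R)).
move=> _ [_ [a [b ->] <-]]; rewrite setTI; apply: open_rVb_measurable.
apply: open_comp; [by move=> ? _; exact: cf|exact: interval_open].
Qed.

Lemma measurable_coord n i : measurable_fun setT (fun x : rVb n => x ord0 i).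
Proof. by apply: (@continuous_rVb_measurable n (fun x => x ord0 i)); apply: coord_continuous. Qed.

(** Every open set is a countable union of max-norm balls with rational centre and radius 1/(k+1),
    and the preimage of such a ball is a finite intersection of conditions on single coordinates. *)
Lemma measurable_rV d (T : measurableType d) n (f : T -> rVb n) :
  (forall i, measurable_fun setT (fun x => f x ord0 i)) -> measurable_fun setT f.
Proof.
move=> mf; apply: (@measurability _ _ T (rVb n) setT f (@open 'rV[R]_n) erefl).
move=> _ [A oA <-].
rewrite setTI.
pose B (qk : 'rV[rat]_n * nat) : set 'rV[R]_n :=
  [set v | forall i, `|v ord0 i - ratr (qk.1 ord0 i)| < qk.2.+1%:R^-1].
have -> : A = \bigcup_(qk in [set qk | B qk `<=` A]) B qk.
  apply/seteqP; split => [x Ax|x [qk /= BA /BA//]].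
  have /nbhs_ballP[e /= e0 eA] := open_nbhs_nbhs (conj oA Ax).
  have [k ke] : exists k : nat, k.+1%:R^-1 < e / 2.
    have := @ltr_add_invr R 0 (e / 2); rewrite divr_gt0// => /(_ isT)[k].
    by rewrite add0r; exists k.
  have /choice[q qx] i : exists q : rat, `|x ord0 i - ratr q| < k.+1%:R^-1.
    have [|q] := @rat_in_itvoo R (x ord0 i - k.+1%:R^-1) (x ord0 i + k.+1%:R^-1).
      by rewrite ltrBlDr -addrA ltrDl addr_gt0.
    by rewrite in_itv/= => qx; exists q; rewrite ltr_distlC.
  exists (\row_i q i, k); last by move=> i; rewrite /= mxE.
  move=> y /= By; apply: eA; split=> // i j.
  rewrite (ord1 i) /ball/=.
  have := By j; have := qx j; rewrite /= mxE.
  rewrite (distrC (y _ _)) => h1 h2.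
  rewrite -(subrKA (ratr (q j))) (le_lt_trans (ler_normD _ _))//.
  by rewrite (lt_trans (ltrD h1 h2))// (splitr e) ltrD.
rewrite preimage_bigcup bigcup_mkcond.
apply: countable_bigcupT_measurable => [|qk]; first exact: countableP.
case: ifP => // _.
rewrite [X in measurable X](_ : _ = \bigcap_(i in [set: 'I_n])
    ((fun x => `|f x ord0 i - ratr (qk.1 ord0 i)|) @^-1` `]-oo, qk.2.+1%:R^-1[%classic)).
  apply: fin_bigcap_measurable; first exact: finite_finset.
  move=> i _; rewrite -[X in measurable X]setTI.
  have mfi : measurable_fun setT (fun x => `|f x ord0 i - ratr (qk.1 ord0 i)|).
    by apply: measurableT_comp => //; exact: measurable_funB.
  by apply: mfi => //; exact: measurable_itv.
by apply/seteqP; split=> [x /= h i _|x /= h i]; [rewrite /= in_itv/=; exact: h|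
   have := h i I; rewrite /= in_itv].
Qed.

Lemma measurable_rcons0 m :
  measurable_fun setT (fun z : R * rVb m => rcons0 z.1 z.2 : rVb m.+1).
Proof.
apply: measurable_rV => i; rewrite /rcons0.
case: (unliftP ord0 i) => [j ->|->].
  apply: (eq_measurable_fun (fun z : R * rVb m => z.2 ord0 j)).
    by move=> x _; rewrite mxE liftK.
  exact: measurableT_comp (measurable_coord j) measurable_snd.
apply: (eq_measurable_fun (fun z : R * rVb m => z.1)).
  by move=> x _; rewrite mxE unlift_none.
exact: measurable_fst.
Qed.
End rV_measurable.

Section sigma_finite_pack.
Context d (T : measurableType d) (R : realType) (nu : {measure set T -> \bar R}).
Hypothesis sf : sigma_finite setT nu.
(* A fresh head constant, so that the instance below is attached to this copy of nu only. *)
Definition sigma_finite_copy of sigma_finite setT nu : set T -> \bar R := nu.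
HB.instance Definition _ := Measure.copy (sigma_finite_copy sf) nu.
HB.instance Definition _ := @Measure_isSigmaFinite.Build _ _ _ (sigma_finite_copy sf) sf.
Definition sigma_finite_pack : {sigma_finite_measure set T -> \bar R} := sigma_finite_copy sf.
End sigma_finite_pack.

(** * The Borel measure behind the iterated integral *)

Section rV_measure.
Variable R : realType.
Local Open Scope ereal_scope.

Definition rVbox n (a b : 'rV[R]_n) : set 'rV[R]_n :=
  [set v | forall i, (a ord0 i <= v ord0 i < b ord0 i)%R].

Lemma measurable_rVbox n (a b : 'rV[R]_n) : measurable (rVbox a b : set (rVb R n)).
Proof.
rewrite [X in measurable X](_ : _ = \bigcap_(i in [set: 'I_n])
    ((fun x : rVb R n => x ord0 i) @^-1` `[a ord0 i, b ord0 i[%classic)).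
  apply: fin_bigcap_measurable; first exact: finite_finset.
  move=> i _; rewrite -[X in measurable X]setTI.
  by apply: measurable_coord => //; exact: measurable_itv.
apply/seteqP; split=> [x /= h i _ /=|x /= h i]; first by rewrite in_itv/=.
by have := h i I; rewrite /= in_itv/=.
Qed.

Lemma rVbox_rcons0 m (a b : 'rV[R]_m.+1) x (v : 'rV[R]_m) :
  \1_(rVbox a b) (rcons0 x v) =
  (\1_(`[a ord0 ord0, b ord0 ord0[%classic) x *
   \1_(rVbox (\row_i a ord0 (lift ord0 i)) (\row_i b ord0 (lift ord0 i))) v)%R :> R.
Proof.
rewrite !indicE -natrM mulnb; congr (_ %:R); congr nat_of_bool.
apply/idP/andP => [/set_mem h|[/set_mem h1 /set_mem h2]].
  split; apply/mem_set.
    by have := h ord0; rewrite /= in_itv/= mxE unlift_none.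
  by move=> i; have := h (lift ord0 i); rewrite !mxE liftK.
apply/mem_set => i; rewrite mxE; case: (unliftP ord0 i) => [j ->|->] /=.
  by have := h2 j; rewrite !mxE.
by move: h1; rewrite /= in_itv.
Qed.


Lemma iint_rVbox n (a b : 'rV[R]_n) : (forall i, a ord0 i <= b ord0 i)%R ->
  iint (fun x => (\1_(rVbox a b) x)%:E) = (\prod_i (b ord0 i - a ord0 i))%:E.
Proof.
elim: n a b => [|m ih] a b ab.
  by rewrite /= big_ord0 indicE mem_set// => -[].
set a' := \row_i a ord0 (lift ord0 i); set b' := \row_i b ord0 (lift ord0 i).
have ab' i : (a' ord0 i <= b' ord0 i)%R by rewrite !mxE.
have E x : iint (fun v : 'rV[R]_m => (\1_(rVbox a b) (rcons0 x v))%:E) =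
    (\1_(`[a ord0 ord0, b ord0 ord0[%classic) x)%:E * (\prod_i (b' ord0 i - a' ord0 i))%:E.
  under eq_fun do rewrite rVbox_rcons0.
  rewrite [in RHS]indicE; case: (boolP (x \in _)) => xI.
    by rewrite mul1e -ih//; congr iint; apply/funext => v; rewrite indicE xI mul1r.
  rewrite mul0e; transitivity (iint (fun _ : 'rV[R]_m => 0 : \bar R)).
    by congr iint; apply/funext => v; rewrite indicE (negbTE xI) mul0r.
  by elim: (m) => //= k ->; rewrite integral0.
rewrite /=; under eq_integral do rewrite E.
rewrite ge0_integralZr//; last 2 first.
- have mI : measurable_fun setT (\1_(`[a ord0 ord0, b ord0 ord0[%classic) : R -> R).
    apply: measurable_indic; exact: measurable_itv.
  by move/measurable_EFinP : mI; apply.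
- by rewrite lee_fin prodr_ge0// => i _; rewrite subr_ge0.
rewrite integral_indic//.
have lI : @lebesgue_measure R `[a ord0 ord0, b ord0 ord0[%classic = (b ord0 ord0 - a ord0 ord0)%:E.
  rewrite lebesgue_measure_itv/= lte_fin; case: ltP => [_|ba]; first by rewrite EFinB.
  by congr EFin; apply/eqP; rewrite eq_sym subr_eq0 eq_le ba ab.
rewrite setIT [X in X * _](_ : _ = (b ord0 ord0 - a ord0 ord0)%:E); last exact: lI.
rewrite big_ord_recl -EFinM; congr (_ * _)%:E.
by apply: eq_bigr => i _; rewrite !mxE.
Qed.

Lemma rVbox_cover n : [set: 'rV[R]_n] = \bigcup_k rVbox (const_mx (- k%:R)%R) (const_mx k%:R%R).
Proof.
apply/seteqP; split=> // x _.
have [k kx] : exists k : nat, forall i, (`|x ord0 i| < k%:R)%R.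
  exists (Num.bound (`|x|)%R) => i; apply: le_lt_trans (archi_boundP _) => //.
  by rewrite [leRHS]/Num.norm/= mx_normrE; apply: (le_bigmax _ _ (ord0, i)).
by exists k => // i; rewrite !mxE; have := kx i; rewrite ltr_norml => /andP[/ltW -> ->].
Qed.

(** In dimension m+1 the measure is the image under [rcons0] of Lebesgue measure times the previous
    one, and Tonelli's theorem unfolds its integral into the iteration. Sigma-finiteness is carried
    through the induction for the sake of Tonelli; it comes from the boxes of [rVbox_cover]. *)
Lemma iint_measureP n : exists mu : {sigma_finite_measure set (rVb R n) -> \bar R},
  forall f : rVb R n -> \bar R, measurable_fun setT f -> (forall x, 0 <= f x) ->
    iint f = \int[mu]_x f x.
Proof.
elim: n => [|m [mu mu_iint]].
  exists (\d_(0%R : rVb R 0)) => f mf f0.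
  by rewrite integral_dirac//= diracT mul1e.
pose phi := fun z : R * rVb R m => rcons0 z.1 z.2 : rVb R m.+1.
have mphi : measurable_fun setT phi by exact: measurable_rcons0.
pose nu : {measure set (rVb R m.+1) -> \bar R} := 
   measure_function_pushforward__canonical__measure_function_Measure (lebesgue_measure \x mu) mphi.
have nu_iint (f : rVb R m.+1 -> \bar R) : measurable_fun setT f -> (forall x, 0 <= f x) ->
    iint f = \int[nu]_x f x.
  move=> mf f0; rewrite /= ge0_integral_pushforward//.
  rewrite preimage_setT fubini_tonelli1; last 2 first.
  - exact: (measurableT_comp mf mphi).
  - by move=> z; exact: f0.
  apply: eq_integral => x _; rewrite mu_iint//.
  apply: (measurableT_comp mf).
  exact: (measurableT_comp mphi (pair1_measurable (x : R))).
have sf : sigma_finite setT nu.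
  exists (fun k => rVbox (const_mx (- k%:R)%R) (const_mx k%:R%R)); first exact: rVbox_cover.
  move=> k; split; first exact: measurable_rVbox.
  rewrite -[X in nu X]setIT -integral_indic//; last exact: measurable_rVbox.
  rewrite -nu_iint.
  - by rewrite iint_rVbox ?ltry// => i; rewrite !mxE ge0_cp.
  - by apply/measurable_EFinP; apply: measurable_indic; exact: measurable_rVbox.
  - by move=> x; rewrite lee_fin.
by exists (sigma_finite_pack sf).
Qed.
End rV_measure.

(** * Euclidean geometry and distance to the boundary *)
Section enorm_lemmas.
Variable R : realType.
Implicit Types n : nat.

Lemma enorm_ge0 n (v : 'rV[R]_n) : 0 <= enorm v.
Proof. exact: sqrtr_ge0. Qed.

Lemma enormN n (v : 'rV[R]_n) : enorm (- v) = enorm v.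
Proof. by rewrite /enorm; congr Num.sqrt; apply: eq_bigr => i _; rewrite mxE sqrrN. Qed.

Lemma enormC n (v w : 'rV[R]_n) : enorm (v - w) = enorm (w - v).
Proof. by rewrite -enormN opprB. Qed.

Lemma coord_le_enorm n (v : 'rV[R]_n) i : `|v ord0 i| <= enorm v.
Proof.
rewrite -sqrtr_sqr ler_sqrt ?sumr_ge0// => [|j _]; last exact: sqr_ge0.
by rewrite (bigD1 i)//= lerDl sumr_ge0// => j _; exact: sqr_ge0.
Qed.

Lemma sqr_enorm n (v : 'rV[R]_n) : enorm v ^+ 2 = \sum_i v ord0 i ^+ 2.
Proof. by rewrite sqr_sqrtr// sumr_ge0// => i _; exact: sqr_ge0. Qed.

Lemma enorm_cauchy_schwarz n (v w : 'rV[R]_n) :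
  \sum_i v ord0 i * w ord0 i <= enorm v * enorm w.
Proof.
set a := enorm v; set b := enorm w.
have [a0 b0] : 0 <= a /\ 0 <= b by split; exact: enorm_ge0.
have : 0 <= \sum_i (b * v ord0 i - a * w ord0 i) ^+ 2.
  by apply: sumr_ge0 => i _; exact: sqr_ge0.
under eq_bigr do rewrite sqrrB !exprMn.
rewrite big_split/= sumrB -!mulr_sumr -!sqr_enorm -/a -/b sumrMnl.
rewrite (eq_bigr (fun i => b * a * (v ord0 i * w ord0 i))); last by move=> i _; ring.
rewrite -mulr_sumr; set S := \sum_i _ => h.
(* If [a * b = 0] the expanded square says nothing, but then one of the vectors is zero and so is
   the sum. *)
have [ab0|ab0] := leP (a * b) 0; last by rewrite -(ler_pM2l ab0); nra.
have {ab0} : a * b = 0 by apply/eqP; rewrite eq_le ab0 mulr_ge0.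
move=> /eqP; rewrite mulf_eq0 => /orP[] /eqP ab; rewrite ab ?(mulr0, mul0r).
  rewrite /S big1// => i _; have := coord_le_enorm v i.
  by rewrite -/a ab normr_le0 => /eqP ->; rewrite mul0r.
rewrite /S big1// => i _; have := coord_le_enorm w i.
by rewrite -/b ab normr_le0 => /eqP ->; rewrite mulr0.
Qed.

Lemma enormD n (v w : 'rV[R]_n) : enorm (v + w) <= enorm v + enorm w.
Proof.
rewrite -(ler_pXn2r (n := 2))// ?nnegrE ?addr_ge0 ?enorm_ge0//.
rewrite sqrrD !sqr_enorm; have h := enorm_cauchy_schwarz v w.
under eq_bigr do rewrite mxE sqrrD.
by rewrite !big_split/= -/(enorm v * enorm w); lra.
Qed.

Lemma enorm_triangle n (x y z : 'rV[R]_n) : enorm (x - z) <= enorm (x - y) + enorm (y - z).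
Proof. by rewrite -(subrKA y) enormD. Qed.

Lemma enorm_le_coord n (v : 'rV[R]_n) (r : R) : (forall i, `|v ord0 i| <= r) ->
  enorm v <= n%:R * r.
Proof.
move=> vr; have [n0|n0] := posnP n.
  by move: v vr; rewrite n0 => v _; rewrite /enorm big_ord0 sqrtr0 mul0r.
have r0 : 0 <= r by exact: le_trans (vr (Ordinal n0)).
rewrite -(ler_pXn2r (n := 2))// ?nnegrE ?mulr_ge0 ?enorm_ge0//.
rewrite sqr_enorm; apply: le_trans (_ : \sum_(i < n) r ^+ 2 <= _).
  by apply: ler_sum => i _; rewrite -[leLHS]ger0_norm ?sqr_ge0// normrX ler_pXn2r ?nnegrE.
rewrite sumr_const card_ord exprMn -[leLHS]mulr_natl ler_wpM2r ?sqr_ge0//.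
by rewrite -natrX ler_nat -{1}(expn1 n) leq_pexp2l.
Qed.

Lemma enormZ n a (v : 'rV[R]_n) : enorm (a *: v) = `|a| * enorm v.
Proof.
rewrite /enorm -sqrtr_sqr -sqrtrM ?sqr_ge0// mulr_sumr; congr Num.sqrt.
by apply: eq_bigr => i _; rewrite mxE exprMn.
Qed.
End enorm_lemmas.

Section dist_lemmas.
Variables (R : realType) (n : nat).
Implicit Types (x y : 'rV[R]_n) (E G : set 'rV[R]_n).

Lemma dist_to_has_inf E x : E !=set0 -> has_inf [set enorm (x - y) | y in E].
Proof.
move=> [e Ee]; split; first by exists (enorm (x - e)), e.
by exists 0 => _ [y _ <-]; exact: enorm_ge0.
Qed.

Lemma dist_to_le E x e : E e -> dist_to x E <= enorm (x - e).
Proof.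
move=> Ee; apply: ge_inf; last by exists e.
by case: (@dist_to_has_inf E x); [exists e|].
Qed.

Lemma le_dist_to E x r : E !=set0 -> (forall e, E e -> r <= enorm (x - e)) -> r <= dist_to x E.
Proof.
move=> [e0 Ee0] rE; apply: lb_le_inf; first by exists (enorm (x - e0)), e0.
by move=> _ [e Ee <-]; exact: rE.
Qed.

Lemma dist_to_ge0 E x : 0 <= dist_to x E.
Proof.
have [->|/set0P E0] := eqVneq E set0; first by rewrite /dist_to image_set0 inf0.
by apply: le_dist_to => // e _; exact: enorm_ge0.
Qed.

Lemma dist_to_lip E x y : E !=set0 -> dist_to x E <= enorm (x - y) + dist_to y E.
Proof.
move=> E0; rewrite -lerBlDl; apply: le_dist_to => // e Ee.
rewrite lerBlDl; apply: le_trans (dist_to_le _ Ee) _; exact: enorm_triangle.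
Qed.

Lemma dist_to_lt E x r : E !=set0 -> dist_to x E < r -> exists2 e, E e & enorm (x - e) < r.
Proof.
move=> E0 xr; have [_ [e Ee <-] exr] := inf_lt (dist_to_has_inf x E0).1 xr.
by exists e.
Qed.

Lemma boundary_open G : open G -> boundary G = closure G `\` G.
Proof. by move=> oG; rewrite /boundary (interior_id G).1. Qed.

(** The library ball is that of the max-norm, which the Euclidean norm dominates, so the same radius
    serves. *)
Lemma ball_sub_eball x (e : R) : 0 < e -> exists2 r : R, 0 < r & eball x r `<=` ball x e.
Proof.
move=> e0; exists e => // y; rewrite /eball/= => yx; split => // i j.
by rewrite (ord1 i) /ball/= distrC -[X in `|X|](_ : (y - x) ord0 j = _)
  ?(le_lt_trans (coord_le_enorm _ _))// !mxE.
Qed.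

Lemma dist_boundary_gt0 G x : open G -> boundary G !=set0 -> G x -> 0 < dist_to x (boundary G).
Proof.
move=> oG b0 Gx; have /nbhs_ballP[e /= e0 eG] := open_nbhs_nbhs (conj oG Gx).
have [r r0 rG] := ball_sub_eball x e0.
apply: lt_le_trans r0 _; apply: le_dist_to => // z; rewrite boundary_open// => -[_ nGz].
by rewrite leNgt; apply/negP => xz; apply/nGz/eG/rG; rewrite /eball/= enormC.
Qed.

(* A segment leaving an open set crosses its boundary. *)
Lemma dist_boundary_le G x y : open G -> G x -> ~ G y ->
  dist_to x (boundary G) <= enorm (x - y).
Proof.
move=> oG Gx nGy; pose f (t : R) := x + t *: (y - x).
have cf : continuous f.
  by move=> t; apply: cvgD; [exact: cvg_cst|apply: cvgZr_tmp; exact: cvg_id].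
have [z [t t01 <-] bz] : exists2 z, (f @` `[0, 1]%classic) z & boundary G z.
  apply: contrapT => nz; pose C := f @` `[0, 1]%classic.
  have cC : connected C.
    apply: connected_continuous_connected; first exact: segment_connected.
    exact: continuous_subspaceT.
  (* If the segment [C] misses the boundary, [G] and its closure meet [C] in the same set, which is
     thus open and closed in the connected set [C]. *)
  have CG : C `&` G = C.
    apply: cC.
    - exists x; split => //; exists 0; first by rewrite /= in_itv/= lexx ler01.
      by rewrite /f scale0r addr0.
    - by exists G.
    - exists (closure G); first exact: closed_closure.
      apply/seteqP; split=> z [Cz Gz]; split => //; first exact: subset_closure.
      apply: contrapT => nGz; apply: nz; exists z => //.
      by rewrite boundary_open.
  apply: nGy; have : C y.
    exists 1; first by rewrite /= in_itv/= lexx ler01.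
    by rewrite /f scale1r addrC subrK.
  by rewrite -CG => -[].
apply: le_trans (dist_to_le _ bz) _.
move: t01; rewrite /= in_itv/= => /andP[t0 t1].
rewrite /f opprD addNKr -scalerN opprB enormZ ger0_norm//.
by rewrite ler_piMl ?enorm_ge0.
Qed.
End dist_lemmas.

(** * Whitney cubes and chains along John curves *)
Section dyadic_cubes.
Variables (R : realType) (n : nat).
Implicit Types (x y : 'rV[R]_n) (q : nat * 'rV[int]_n).

Definition dyadic_side (j : nat) : R := 2^-1 ^+ j.

Definition dyadic_id (j : nat) x : 'rV[int]_n := \row_i Num.floor (x ord0 i / dyadic_side j).

Definition dyadic_cube q : set 'rV[R]_n :=
  rVbox (\row_i ((q.2 ord0 i)%:~R * dyadic_side q.1))
        (\row_i ((q.2 ord0 i)%:~R * dyadic_side q.1 + dyadic_side q.1)).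

Lemma dyadic_side_gt0 j : 0 < dyadic_side j.
Proof. by rewrite exprn_gt0. Qed.

Lemma dyadic_side_le1 j : dyadic_side j <= 1.
Proof. by rewrite exprn_ile1// invf_le1 ?ler1n. Qed.

Lemma dyadic_sideS j : dyadic_side j = 2 * dyadic_side j.+1.
Proof. by rewrite /dyadic_side exprS; lra. Qed.

Lemma dyadic_cubeP q x : dyadic_cube q x <-> dyadic_id q.1 x = q.2.
Proof.
have l0 := dyadic_side_gt0 q.1.
split=> [h|h i]; last first.
  rewrite !mxE -h !mxE -ler_pdivlMr// ge_floor/=.
  by rewrite -[X in _ + X]mul1r -mulrDl -ltr_pdivrMr// -[1]/(1%:~R) -intrD floorD1_gt.
apply/rowP => i; rewrite mxE; apply: floor_def; have := h i.
by rewrite !mxE ler_pdivlMr// ltr_pdivrMr// intrD mulrDl mul1r.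
Qed.

Lemma dyadic_cube_id j x : dyadic_cube (j, dyadic_id j x) x.
Proof. exact/dyadic_cubeP. Qed.

(** One halving at a time: 2 floor(c) <= floor(2c) < 2 floor(c) + 2, so floor(2c) determines
    floor(c). *)
Lemma dyadic_id_nested i j x y : (i <= j)%N ->
  dyadic_id j x = dyadic_id j y -> dyadic_id i x = dyadic_id i y.
Proof.
move=> /subnK <-; elim: (j - i)%N => // k ih /rowP xy; apply: ih; apply/rowP => l.
have := xy l; rewrite !mxE addSn; set m := (k + i)%N.
have E (z : R) : z / dyadic_side m.+1 = 2 * (z / dyadic_side m).
  have := dyadic_side_gt0 m.+1; rewrite (dyadic_sideS m) => h; field; lra.
rewrite !E; set a := x _ _ / _; set b := y _ _ / _ => ab.
have F (c : R) : (2 * Num.floor c <= Num.floor (2 * c) < 2 * Num.floor c + 2)%R.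
  have /andP[h1 h2] := floor_itv c; rewrite floor_ge_int_tmp floor_lt_int.
  rewrite !intrD !intrM; rewrite intrD in h2; apply/andP; split; lra.
have := F a; have := F b; rewrite ab; lia.
Qed.

Lemma dyadic_cube_diam q x y : dyadic_cube q x -> dyadic_cube q y ->
  enorm (x - y) <= n%:R * dyadic_side q.1.
Proof.
move=> qx qy; apply: enorm_le_coord => i.
have := qx i; have := qy i; rewrite !mxE => /andP[h1 h2] /andP[h3 h4].
by rewrite ler_norml; apply/andP; split; lra.
Qed.

(* [wq x] is the largest dyadic cube of level >= 0 around x that lies in G and on which
   dist(., bdry G) >= K * side; maximality gives the upper bound on the distance. *)
Lemma whitney_cubes (G : set 'rV[R]_n) (K D : R) :
  0 < K -> open G -> boundary G !=set0 ->
  (forall x, G x -> dist_to x (boundary G) <= D) ->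
  exists wq : 'rV[R]_n -> nat * 'rV[int]_n, forall x, G x ->
    [/\ dyadic_cube (wq x) x, forall y, dyadic_cube (wq x) y -> G y /\ wq y = wq x,
        K * dyadic_side (wq x).1 <= dist_to x (boundary G) &
        dist_to x (boundary G) <= Num.max D (2 * (n%:R + K)) * dyadic_side (wq x).1].
Proof.
move=> K0 oG b0 dD; set d := fun x => dist_to x (boundary G).
pose good j x := forall y, dyadic_id j y = dyadic_id j x -> G y /\ K * dyadic_side j <= d y.
have ex_good x : G x -> exists j, good j x.
  move=> Gx; have dx := dist_boundary_gt0 oG b0 Gx.
  (* At such a level the cube stays within [n] sides of [x], so it lies in [G] and its points keep
     [K] sides of distance to the boundary. *)
  have [j jx] : exists j, (n%:R + K) * dyadic_side j < d x.
    have nK : 0 <= (n%:R + K) / d x by rewrite divr_ge0 ?addr_ge0 ?(ltW K0) ?(ltW dx).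
    exists (Num.bound ((n%:R + K) / d x)).
    rewrite /dyadic_side exprVn ltr_pdivrMr ?exprn_gt0// -ltr_pdivrMl//.
    rewrite mulrC (lt_le_trans (archi_boundP nK))// -natrX ler_nat.
    exact/ltnW/ltn_expl.
  exists j => y yx.
  have xy : enorm (x - y) <= n%:R * dyadic_side j.
    by apply: (@dyadic_cube_diam (j, dyadic_id j x)); apply/dyadic_cubeP.
  have l0 := dyadic_side_gt0 j.
  split.
    apply: contrapT => nGy; have := dist_boundary_le oG Gx nGy; rewrite -/(d x) => h.
    nra.
  have := dist_to_lip x y b0; rewrite -/(d x) -/(d y) => h; lra.
have : forall x, exists j, G x -> good j x /\ forall i, (i < j)%N -> ~ good i x.
  move=> x; have [Gx|nGx] := pselect (G x); last by exists 0%N.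
  have [j0 gj0] := ex_good x Gx.
  have ex : exists j, `[< good j x >] by exists j0; apply/asboolP.
  exists (ex_minn ex) => _; case: ex_minnP => j /asboolP gj jmin; split => // i ij /asboolP gi.
  by have := jmin _ gi; rewrite leqNgt ij.
move=> /choice[lev levP].
(* Goodness depends only on the cube, and by nesting two points of one cube share all coarser cubes,
   so the least good level is constant on the cube. *)
have levE x y : G x -> dyadic_id (lev x) y = dyadic_id (lev x) x -> G y /\ lev y = lev x.
  move=> Gx yx; have [gx minx] := levP x Gx.
  have Gy := (gx y yx).1; split => //; have [gy miny] := levP y Gy.
  have gyx : good (lev x) y by move=> z zy; apply: gx; rewrite zy.
  case: (ltngtP (lev y) (lev x)) => // h.
    exfalso; apply: (minx _ h) => z zx; apply: gy; rewrite zx.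
    by rewrite (dyadic_id_nested (ltnW h) yx).
  by exfalso; exact: (miny _ h gyx).
exists (fun x => (lev x, dyadic_id (lev x) x)) => x Gx; split => /=.
- exact: dyadic_cube_id.
- by move=> y /dyadic_cubeP/= yx; have [Gy ->] := levE x y Gx yx; rewrite yx.
- by have [gx _] := levP x Gx; have [] := gx x erefl.
have [gx minx] := levP x Gx; have l0 := dyadic_side_gt0 (lev x).
(* Level 0 has no parent, and [D] bounds the distance. Otherwise the parent is not good: it has a
   point outside [G] or closer to the boundary than [K] parent sides, and a parent side is two sides
   of the cube. *)
case E : (lev x) => [|i] in minx l0 *.
  by rewrite /dyadic_side expr0 mulr1 le_max dD.
apply: le_trans (_ : 2 * (n%:R + K) * dyadic_side i.+1 <= _); last first.
  by rewrite ler_pM2r// le_max lexx orbT.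
have := minx i (ltnSn i) => /existsNP[y] /not_implyP[yx ny].
have xy : enorm (x - y) <= n%:R * dyadic_side i.
  by apply: (@dyadic_cube_diam (i, dyadic_id i x)); apply/dyadic_cubeP.
rewrite (mulrC 2) -mulrA -dyadic_sideS.
have [Gy|nGy] := pselect (G y).
  have h := dist_to_lip x y b0; rewrite -/(d y) in h.
  have : ~ (K * dyadic_side i <= d y) by move=> hy; apply: ny.
  by move=> /negP; rewrite -ltNge; lra.
have h := dist_boundary_le oG Gx nGy; apply: le_trans h _; apply: le_trans xy _.
by rewrite ler_pM2r ?dyadic_side_gt0// lerDl ltW.
Qed.
End dyadic_cubes.

Section chains.
Variables (R : realType) (n : nat) (I : eqType).
Variables (d : 'rV[R]_n -> R) (w : 'rV[R]_n -> I) (lev : I -> nat) (e : rel I).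
Variables (K kappa : R).

(* March along g with time steps kappa * d(g t). A step starting in a cube of level j lasts at
   least kappa * K * 2^-j, whence the bound on the number of cubes of each level. *)
Lemma chain_along (g : R -> 'rV[R]_n) (l eta : R) :
  0 <= l -> 0 < kappa -> 0 < eta -> 0 <= K ->
  (forall t : R, 0 <= t <= l -> eta <= d (g t)) ->
  (forall t : R, 0 <= t <= l -> K * dyadic_side R (lev (w (g t))) <= d (g t)) ->
  (forall t t' : R, 0 <= t -> t <= t' -> t' <= l -> t' - t <= kappa * d (g t) ->
     e (w (g t)) (w (g t'))) ->
  exists s : seq I, [/\ path e (w (g 0)) s, last (w (g 0)) s = w (g l),
   forall r, r \in w (g 0) :: s -> exists2 t : R, 0 <= t <= l & r = w (g t) &
   forall j (L : R), 0 <= L ->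
     (forall t : R, 0 <= t <= l -> lev (w (g t)) = j -> t + kappa * d (g t) <= L) ->
     (count (fun r => lev r == j) (w (g 0) :: s))%:R * (kappa * (K * dyadic_side R j)) <=
       L + 2 * (kappa * (K * dyadic_side R j))].
Proof.
move=> l0 k0 eta0 K0 d_eta d_K eP.
pose W j := kappa * (K * dyadic_side R j).
have W0 j : 0 <= W j by rewrite !mulr_ge0 ?(ltW k0)// ltW// dyadic_side_gt0.
(* The claim for the curve after time [t], with the remaining budget [L - t] for [L]; the extra
   [2 * W j] pays for the two cubes of the last step. *)
pose P (t : R) := exists s : seq I, [/\ path e (w (g t)) s, last (w (g t)) s = w (g l),
     forall r, r \in w (g t) :: s -> exists2 t' : R, 0 <= t' <= l & r = w (g t') &
     forall j (L : R), 0 <= L ->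
       (forall t : R, 0 <= t <= l -> lev (w (g t)) = j -> t + kappa * d (g t) <= L) ->
       (count (fun r => lev r == j) (w (g t) :: s))%:R * W j <= Num.max (L - t) 0 + 2 * W j].
have stop (t : R) : 0 <= t <= l -> l < t + kappa * d (g t) -> P t.
  move=> /[dup] tl /andP[t0 tl'] ltk; exists [:: w (g l)]; split => //=.
  - by rewrite andbT; apply: eP => //; lra.
  - move=> r; rewrite !inE => /orP[]/eqP ->; first by exists t.
    by exists l; rewrite // l0 lexx.
  move=> j L L0 _; rewrite addn0.
  apply: le_trans (_ : 2 * W j <= _); last by rewrite lerDr le_max lexx orbT.
  by rewrite ler_wpM2r// (ler_nat _ _ 2); case: (_ == j); case: (_ == j).
(* Each step lasts at least [kappa * eta], so [m] bounds the number of steps left. *)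
have main m (t : R) : 0 <= t <= l -> l - t <= m%:R * (kappa * eta) -> P t.
  elim: m t => [|m ih] t /[dup] tl /andP[t0 tl'] lt;
    have [|ltk] := ltP l (t + kappa * d (g t)); try exact: stop.
    have : kappa * eta <= kappa * d (g t) by rewrite ler_pM2l// d_eta.
    have : 0 < kappa * eta by rewrite mulr_gt0.
    by move: lt; rewrite mul0r => lt h1 h2; exfalso; lra.
  have dt := d_eta _ tl; have kd : kappa * eta <= kappa * d (g t) by rewrite ler_pM2l.
  have ke0 : 0 < kappa * eta by rewrite mulr_gt0.
  set t' := t + kappa * d (g t).
  have t'l : 0 <= t' <= l by rewrite ltk andbT /t'; lra.
  have [|s [ps ls rs cs]] := ih t' t'l.
    by rewrite -natr1 in lt; rewrite /t'; lra.
  exists (w (g t') :: s); split => //=.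
  - by rewrite ps andbT; apply: eP => //; rewrite /t'; [lra|rewrite addrAC subrr add0r].
  - by move=> r; rewrite inE => /orP[/eqP ->|/rs//]; exists t.
  move=> j L L0 HL; have /= := cs j L L0 HL.
  set N := (_ + count _ s)%N; set M := N%:R * W j => h.
  (* A cube of level [j] costs [W j], at most the length of the step taken from it, and by the
     hypothesis on [L] the budget is still nonnegative at [t']. *)
  rewrite natrD [leLHS]mulrDl -/M; case: eqP => [wj|_] /=.
    rewrite mul1r; have t'L := HL t tl wj.
    have Wd : W j <= kappa * d (g t) by rewrite /W -wj ler_pM2l// d_K.
    by move: h; rewrite /t' !max_l; lra.
  rewrite mul0r add0r; apply: le_trans h _; rewrite lerD2r.
  by rewrite ge_max !le_max lexx orbT andbT lerD2l lerN2 /t' lerDl; apply/orP; left; lra.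
have ke0 : 0 < kappa * eta by rewrite mulr_gt0.
have [||s [ps ls rs cs]] := main (Num.bound (l / (kappa * eta))) 0; first by rewrite lexx.
  by rewrite subr0 -ler_pdivrMr// ltW// archi_boundP// divr_ge0// ltW.
exists s; split => // j L L0 HL; have := cs j L L0 HL.
by rewrite subr0 max_l.
Qed.
End chains.

Section john_chains.
Variables (R : realType) (n : nat).
Implicit Types (G : set 'rV[R]_n) (q : nat * 'rV[int]_n).

Lemma arclength_lipschitz (g : R -> 'rV[R]_n) (l a b : R) :
  arclength_param g l -> 0 <= a -> a <= b -> b <= l -> enorm (g a - g b) <= b - a.
Proof.
move=> gl a0 ab bl; rewrite -lee_fin -(gl a b a0 ab bl) enormC.
apply: ereal_sup_ubound; exists 1%N, (fun i => if i == 0%N then a else b); split => //.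
  by case.
by rewrite big_ord_recl big_ord0 addr0.
Qed.

(** The distance is measured from the first cube, so that the inner integral at each of its points
    covers the whole second cube. *)
Definition whitney_adm G (tau : R) : rel (nat * 'rV[int]_n) := fun q q' =>
  `[< forall x y, dyadic_cube q x -> dyadic_cube q' y ->
      [/\ G x, G y & enorm (x - y) < tau * dist_to x (boundary G)] >].

(* A John curve meeting a cube of level j at time t has t^s / c <= C 2^-j, so it started
   within C * shadow_radius s j of that cube. *)
Definition shadow_radius (s : R) (j : nat) : R := dyadic_side R j `^ s^-1.

Lemma le_shadow_radius s j : 1 <= s -> dyadic_side R j <= shadow_radius s j.
Proof.
move=> s1; rewrite ger1_powR ?dyadic_side_gt0 ?dyadic_side_le1//.
by rewrite invf_le1 ?(lt_le_trans _ s1).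
Qed.

Lemma john_chains G (s tau D c : R) (x0 : 'rV[R]_n) :
  (0 < n)%N -> open G -> boundary G !=set0 ->
  (forall x, G x -> dist_to x (boundary G) <= D) ->
  1 <= s -> 0 < tau -> tau < 1 -> 0 < c -> G x0 ->
  (forall x, G x -> exists (l : R) (g : R -> 'rV[R]_n),
      [/\ 0 <= l /\ l <= c, g 0 = x, g l = x0, arclength_param g l &
        forall t, 0 <= t -> t <= l ->
          G (g t) /\ t `^ s / c <= dist_to (g t) (boundary G)]) ->
  exists (wq : 'rV[R]_n -> nat * 'rV[int]_n) (A B : R)
    (chain : nat * 'rV[int]_n -> seq (nat * 'rV[int]_n)),
  [/\ 0 < A, 0 < B,
   forall x, G x -> [/\ dyadic_cube (wq x) x,
     forall y, dyadic_cube (wq x) y -> G y /\ wq y = wq x,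
     16 * n%:R / tau * dyadic_side R (wq x).1 <= dist_to x (boundary G) &
     dist_to x (boundary G) <= A * dyadic_side R (wq x).1] &
   forall x, G x ->
   [/\ path (whitney_adm G tau) (wq x) (chain (wq x)), last (wq x) (chain (wq x)) = wq x0,
     uniq (wq x :: chain (wq x)),
     forall r, r \in wq x :: chain (wq x) -> exists z, [/\ G z, r = wq z &
       forall y, dyadic_cube (wq x) y -> enorm (y - z) <= B * shadow_radius s r.1 /\
         dist_to y (boundary G) <= B * shadow_radius s r.1] &
     forall j, (count (fun r => r.1 == j) (wq x :: chain (wq x)))%:R * dyadic_side R j
       <= B * shadow_radius s j]].
Proof.
move=> n0 oG b0 dD s1 tau0 tau1 c0 Gx0 john.
have s0 : 0 < s by exact: lt_le_trans s1.
(* With this [K] a Whitney cube has diameter at most [tau / 16] times the distance of each of its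
   points to the boundary; two such diameters and a step of [tau / 8] stay within the radius allowed
   by [whitney_adm]. *)
set K := 16 * n%:R / tau; set d := fun x => dist_to x (boundary G).
have nR0 : 0 < n%:R :> R by rewrite ltr0n.
have K0 : 0 < K by rewrite divr_gt0// mulr_gt0.
have [wq wqP] := whitney_cubes K0 oG b0 dD; set A := Num.max _ _ in wqP.
have A0 : 0 < A by rewrite lt_max; apply/orP; right; rewrite mulr_gt0// addr_gt0.
have nK j (x : R) : K * dyadic_side R j <= x -> n%:R * dyadic_side R j <= tau / 16 * x.
  have -> : n%:R * dyadic_side R j = tau / 16 * (K * dyadic_side R j).
    by rewrite /K; field; rewrite gt_eqF.
  by rewrite ler_pM2l// divr_gt0.
pose kappa := tau / 8.
have kappa0 : 0 < kappa by rewrite divr_gt0.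
(* Solving t^s / c <= A 2^-j for t gives t <= T 2^(-j/s). *)
pose T := (c * A) `^ s^-1.
have T0 : 0 <= T by exact: powR_ge0.
have wadm a b : G a -> G b -> enorm (a - b) <= kappa * d a -> whitney_adm G tau (wq a) (wq b).
  move=> Ga Gb ab; have [qa ca Ka _] := wqP a Ga; have [qb cb Kb _] := wqP b Gb.
  apply/asboolP => u v qu qv.
  have [Gu _] := ca u qu; have [Gv _] := cb v qv; split => //.
  have ua := le_trans (dyadic_cube_diam qu qa) (nK _ _ Ka).
  have bv := le_trans (dyadic_cube_diam qb qv) (nK _ _ Kb).
  have h1 := enorm_triangle u a v; have h2 := enorm_triangle a b v.
  have h3 := dist_to_lip b a b0; have h4 := dist_to_lip a u b0.
  rewrite (enormC b a) in h3; rewrite (enormC a u) in h4.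
  rewrite /kappa in ab.
  have da : 0 < d a by exact: dist_boundary_gt0.
  rewrite -/(d a) -/(d b) -/(d u) in ab ua bv h3 h4 *.
  have h5 : tau * (tau * d a) <= tau * d a by rewrite ler_pM2l// ler_piMl// ltW.
  have h6 : 0 < tau * d a by rewrite mulr_gt0.
  have h7 : tau / 16 * d b <= tau / 16 * (d a + tau / 8 * d a) by rewrite ler_pM2l; lra.
  have h8 : tau * (d a - tau / 16 * d a) <= tau * d u by rewrite ler_pM2l; lra.
  lra.
(* The first two summands cover the distances; the quotient covers the number of cubes per level,
   from [chain_along] with L = T h + kappa A 2^-j, where h is the shadow radius. *)
pose B := 2 * T + 2 * A + (T + kappa * A + 2 * (kappa * K)) / (kappa * K).
have kK0 : 0 < kappa * K by rewrite mulr_gt0.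
have B3 : 0 < (T + kappa * A + 2 * (kappa * K)) / (kappa * K).
  by apply: divr_gt0 => //; have := mulr_gt0 kappa0 A0; lra.
have B0 : 0 < B by rewrite /B; lra.
(* The chain must depend on the cube alone, so it follows the curve of one point of the cube; the
   other points are off by at most its diameter, which [B] absorbs. *)
have main q : exists p, forall x, G x -> wq x = q ->
   [/\ path (whitney_adm G tau) q p, last q p = wq x0,
     uniq (q :: p),
     forall r, r \in q :: p -> exists z, [/\ G z, r = wq z &
       forall y, dyadic_cube q y -> enorm (y - z) <= B * shadow_radius s r.1 /\
         dist_to y (boundary G) <= B * shadow_radius s r.1] &
     forall j, (count (fun r => r.1 == j) (q :: p))%:R * dyadic_side R j
       <= B * shadow_radius s j].
  have [[x Gx wxq]|nx] := pselect (exists2 x, G x & wq x = q); last first.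
    by exists [::] => x Gx wxq; exfalso; apply: nx; exists x.
  have [qx cx Kx Ax] := wqP x Gx.
  have [l [g [[l0 lc] g0 gl garc gP]]] := john x Gx.
  have dx : 0 < d x by exact: dist_boundary_gt0.
  (* The John bound vanishes at time 0, so a positive lower bound takes two regimes: up to time
     [d x / 2] the curve is within [d x / 2] of [x]; afterwards the John bound applies. *)
  pose eta := Num.min (d x / 2) ((d x / 2) `^ s / c).
  have eta0 : 0 < eta by rewrite lt_min divr_gt0// divr_gt0// powR_gt0// divr_gt0.
  have gx t : 0 <= t <= l -> enorm (x - g t) <= t.
    by move=> /andP[t0 tl]; have := arclength_lipschitz garc (lexx 0) t0 tl; rewrite g0 subr0.
  have [|||p [pp pl pr pc]] := @chain_along R n _ d wq (fun r => r.1) (whitney_adm G tau)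
      K kappa g l eta l0 kappa0 eta0 (ltW K0).
  - move=> t tl; have /andP[t0 tl'] := tl; rewrite /eta ge_min.
    have [td|td] := leP t (d x / 2).
      have := dist_to_lip x (g t) b0; have := gx t tl.
      by rewrite -/(d x) -/(d (g t)) => h1 h2; apply/orP; left; lra.
    apply/orP; right; apply: le_trans (gP t t0 tl').2.
    rewrite ler_pM2r ?invr_gt0// ge0_ler_powR// ?nnegrE; lra.
  - by move=> t /andP[t0 tl]; have [Gt _] := gP t t0 tl; have [] := wqP _ Gt.
  - move=> t t' t0 tt' t'l h; apply: wadm.
    + by have [] := gP t t0 (le_trans tt' t'l).
    + by have [] := gP t' (le_trans t0 tt') t'l.
    + exact: le_trans (arclength_lipschitz garc t0 tt' t'l) h.
  have tT t : 0 <= t <= l -> t <= T * shadow_radius s (wq (g t)).1.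
    move=> /andP[t0 tl]; have [Gt ht] := gP t t0 tl; have [_ _ _ At] := wqP _ Gt.
    rewrite /T /shadow_radius -powRM ?mulr_ge0 ?(ltW A0) ?(ltW c0) ?(ltW (dyadic_side_gt0 _ _))//.
    rewrite -[leLHS]powRr1// -(mulfV (lt0r_neq0 s0)) powRrM.
    rewrite ge0_ler_powR ?nnegrE ?invr_ge0 ?powR_ge0 ?(ltW s0)//.
      by rewrite !mulr_ge0 ?(ltW A0) ?(ltW c0) ?(ltW (dyadic_side_gt0 _ _)).
    by rewrite -mulrA -ler_pdivrMl// mulrC (le_trans ht).
  have Ash j : A * dyadic_side R j <= A * shadow_radius s j.
    by rewrite ler_pM2l// le_shadow_radius.
  have sr0 j : 0 <= shadow_radius s j by exact: powR_ge0.
  have BE j : B * shadow_radius s j = 2 * T * shadow_radius s j + 2 * A * shadow_radius s j +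
      (T + kappa * A + 2 * (kappa * K)) / (kappa * K) * shadow_radius s j.
    by rewrite /B !mulrDl.
  have E3 j : 0 <= (T + kappa * A + 2 * (kappa * K)) / (kappa * K) * shadow_radius s j.
    by rewrite mulr_ge0// ltW.
  exists (shorten (wq x) p) => x' Gx' wx'.
  rewrite g0 in pp pl pr pc; rewrite -wxq -gl -pl.
  case: (shortenP pp) => p' pp' up' sp'.
  have memp' r : r \in wq x :: p' -> r \in wq x :: p.
    by rewrite !inE => /orP[->//|/sp' ->]; rewrite orbT.
  split => //.
  - move=> r /memp' /pr[t tl ->]; have /andP[t0 tl'] := tl.
    have [Gt ht] := gP t t0 tl'; exists (g t); split => // y qy.
    have [_ _ _ At] := wqP _ Gt; rewrite -/(d _) in At.
    have h1 := tT t tl; have h2 := Ash (wq (g t)).1.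
    have h3 := le_trans (dyadic_cube_diam qy qx) (nK _ _ Kx).
    have h4 := dist_to_lip x (g t) b0; have h5 := gx t tl.
    have h6 := enorm_triangle y x (g t); have h7 := dist_to_lip y (g t) b0.
    rewrite -/(d x) -/(d y) -/(d (g t)) in h3 h4 h7 *.
    have h8 : tau / 16 * d x <= d x by rewrite ler_piMl ?(ltW dx)//; lra.
    have h9 := E3 (wq (g t)).1; have h10 : 0 <= d (g t) := dist_to_ge0 _ _.
    rewrite BE; set E := _ / _ * _ in h9 *; split; lra.
  (* The cubes of the shortened chain are distinct and occur in the original one, so the count of
     each level can only drop. *)
  move=> j; have cc : (count (fun r : nat * 'rV[int]_n => r.1 == j) (wq x :: p')
      <= count (fun r => r.1 == j) (wq x :: p))%N.
    rewrite -!size_filter; apply: uniq_leq_size; first exact: filter_uniq.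
    by move=> r; rewrite !mem_filter => /andP[-> /memp' ->].
  have l0' := dyadic_side_gt0 R j.
  apply: le_trans (_ : (count (fun r => r.1 == j) (wq x :: p))%:R * dyadic_side R j <= _).
    by rewrite ler_pM2r// ler_nat.
  have := pc j (T * shadow_radius s j + kappa * A * dyadic_side R j).
  have L0 : 0 <= T * shadow_radius s j + kappa * A * dyadic_side R j.
    by apply: addr_ge0; [exact: mulr_ge0|rewrite ltW// !mulr_gt0].
  move=> /(_ L0); set N := _%:R => h.
  have {}h : N * (kappa * (K * dyadic_side R j)) <=
     T * shadow_radius s j + kappa * A * dyadic_side R j + 2 * (kappa * (K * dyadic_side R j)).
    apply: h => t tl tj; have := tT t tl; rewrite tj => h1.
    have /andP[t0 tl'] := tl; have [Gt _] := gP t t0 tl'; have [_ _ _] := wqP _ Gt.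
    rewrite tj -/(d _) => h2; apply: lerD => //.
    by rewrite -mulrA ler_pM2l.
  apply: le_trans (_ : (T + kappa * A + 2 * (kappa * K)) / (kappa * K) * shadow_radius s j <= _).
    rewrite mulrAC ler_pdivlMr//.
    have h2 : kappa * A * dyadic_side R j <= kappa * A * shadow_radius s j.
      by rewrite ler_pM2l ?le_shadow_radius// mulr_gt0.
    have h3 : kappa * K * dyadic_side R j <= kappa * K * shadow_radius s j.
      by rewrite ler_pM2l ?le_shadow_radius.
    by rewrite -mulrA; move: h h2 h3; lra.
  by rewrite BE lerDr addr_ge0// mulr_ge0// ?mulr_ge0// ltW.
have [chain chainP] := choice main.
exists wq, A, B, chain; split => // x Gx.
exact: (chainP (wq x) x Gx erefl).
Qed.
End john_chains.

(** * Borel versions, averages and Jensen's inequality *)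
Section borel_version.
Variables (R : realType) (n : nat) (mu : {measure set (rVb R n) -> \bar R}).
Hypothesis mu_iint : forall f : rVb R n -> \bar R, measurable_fun setT f ->
  (forall x, 0 <= f x)%E -> iint f = (\int[mu]_x f x)%E.

Lemma vol_measurable (A : set (rVb R n)) : measurable A -> vol A = mu A.
Proof.
move=> mA; rewrite /vol mu_iint.
- by rewrite integral_indic// setIT.
- by apply/measurable_EFinP; exact: measurable_indic.
- by move=> x; rewrite lee_fin.
Qed.

Lemma mu_rVbox (a b : 'rV[R]_n) : (forall i, a ord0 i <= b ord0 i) ->
  mu (rVbox a b) = (\prod_i (b ord0 i - a ord0 i))%:E.
Proof.
move=> ab; rewrite -vol_measurable; last exact: measurable_rVbox.
by rewrite /vol iint_rVbox.
Qed.

Lemma mu_dyadic_cube q : mu (dyadic_cube q) = (dyadic_side R q.1 ^+ n)%:E.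
Proof.
rewrite mu_rVbox => [|i]; last by rewrite !mxE lerDl ltW// dyadic_side_gt0.
congr EFin; rewrite (eq_bigr (fun=> dyadic_side R q.1)) ?prodr_const ?card_ord// => i _.
by rewrite !mxE addrAC subrr add0r.
Qed.

Lemma lnull_cover (N : set 'rV[R]_n) : lnull N ->
  exists B : set (rVb R n), [/\ measurable B, N `<=` B & mu B = 0%E].
Proof.
by move=> [B [bB [NB vB]]]; exists B; split => //; rewrite -vol_measurable.
Qed.

(** For each rational [a] the set of points of [G] with [u > a] is Borel up to a null set. The
    countable union of Borel null covers of these exceptional sets serves all [a] at once. *)
Lemma borel_version (G : set 'rV[R]_n) (u : 'rV[R]_n -> R) : open G ->
  lmeasurable_fun_on G u ->
  exists N : set (rVb R n), [/\ measurable N, mu N = 0%E &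
    measurable_fun setT ((fun x => \1_(G `\` N) x * u x) : rVb R n -> R)].
Proof.
move=> oG mu_u.
have : forall a : rat, exists N : set (rVb R n), [/\ measurable N, mu N = 0%E &
    measurable ((G `&` [set x | ratr a < u x]) `\` N : set (rVb R n))].
  move=> a; have oa : open (`](ratr a : R), +oo[%classic : set R) by exact: interval_open.
  have [B [bB nB]] := mu_u _ oa.
  have [N [mN BN N0]] := lnull_cover nB; exists N; split => //.
  rewrite [X in measurable X](_ : _ = B `\` N); first exact: measurableD.
  apply/seteqP; split=> x [/=].
    move=> [Gx ux] nNx; split => //; apply: contrapT => nBx; apply/nNx/BN; left; split => //.
    by split => //=; rewrite in_itv/= ux.
  move=> Bx nNx; split => //; apply: contrapT => nux; apply/nNx/BN; right; split => //.
  by move=> [Gx /=]; rewrite in_itv/= andbT => ux; apply: nux.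
move=> /choice[N NP]; pose M := \bigcup_k oapp N set0 (unpickle k).
have mN k : measurable (oapp N set0 (unpickle k) : set (rVb R n)).
  by case: unpickle => [a|]//=; have [] := NP a.
have mM : measurable (M : set (rVb R n)) by apply: bigcupT_measurable.
exists M; split => //.
  have : mu.-negligible M.
    apply: negligible_bigcup => k; apply/negligibleP => //.
    by case: unpickle => [a|]/=; [have [] := NP a|rewrite measure0].
  by move/negligibleP; exact.
have NM a : N a `<=` M.
  move=> x Nx; have [k kx] : exists k, oapp N set0 (unpickle k) x.
    by exists (pickle a); rewrite pickleK.
  by exists k.
have mG : measurable (G : set (rVb R n)) by exact: open_rVb_measurable.
have mGM : measurable (G `\` M : set (rVb R n)) by exact: measurableD.
set v := (fun x => _).
have mv (a : rat) : measurable (v @^-1` `](ratr a : R), +oo[%classic : set (rVb R n)).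
  have mA : measurable (((G `&` [set x | ratr a < u x]) `\` N a) `\` M : set (rVb R n)).
    by apply: measurableD => //; have [] := NP a.
  (* Off G minus [M] the function [v] is 0, so that complement belongs to the superlevel set exactly
     when the level is negative. *)
  have [a0|a0] := leP 0 (ratr a : R).
    rewrite [X in measurable X](_ : _ = ((G `&` [set x | ratr a < u x]) `\` N a) `\` M)//.
    apply/seteqP; split=> x /=; rewrite in_itv/= andbT /v indicE.
      case: (boolP (x \in _)) => [/set_mem[Gx nMx]|_].
        by rewrite mul1r => ux; split => //; split => // /NM.
      by rewrite mul0r ltNge a0.
    by move=> [[[Gx ux] nNx] nMx]; rewrite mem_set ?mul1r.
  rewrite [X in measurable X](_ : _ = (((G `&` [set x | ratr a < u x]) `\` N a) `\` M) `|` ~` (G `\` M)).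
    by apply: measurableU => //; exact: measurableC.
  apply/seteqP; split=> x /=; rewrite in_itv/= andbT /v indicE.
    case: (boolP (x \in _)) => [/set_mem[Gx nMx]|/negP nx _].
      by rewrite mul1r => ux; left; split => //; split => // /NM.
    by right => GMx; apply: nx; exact: mem_set.
  move=> [[[[Gx ux] nNx] nMx]|nGM]; first by rewrite mem_set ?mul1r.
  by rewrite memNset// mul0r.
apply: (measurability _ (RGenOInfty.measurableE R)) => _ [_ [r ->] <-]; rewrite setTI.
rewrite [X in measurable X](_ : _ = \bigcup_(a in [set a : rat | r < ratr a])
    (v @^-1` `](ratr a : R), +oo[%classic)).
  rewrite bigcup_mkcond; apply: countable_bigcupT_measurable => [|a]; first exact: countableP.
  by case: ifP.
apply/seteqP; split=> x /=; rewrite in_itv/= andbT.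
  move=> /rat_in_itvoo[a]; rewrite in_itv/= => /andP[ra av]; exists a => //=.
  by rewrite in_itv/= andbT.
by move=> [a /= ra]; rewrite in_itv/= andbT; exact: lt_trans.
Qed.
End borel_version.

Section tangent.
Variable R : realType.

(* The tangent line of the convex function [a |-> a `^ p] at [b]. *)
Lemma powR_tangent (p a b : R) : 1 < p -> 0 <= a -> 0 <= b ->
  p * (b `^ (p - 1) * a) <= a `^ p + (p - 1) * b `^ p.
Proof.
move=> p1 a0 b0; have p0 : 0 < p by exact: lt_trans p1.
have q0 : 0 < p / (p - 1) by rewrite divr_gt0// subr_gt0.
have pq : p^-1 + (p / (p - 1))^-1 = 1.
  by rewrite invf_div; field; rewrite gt_eqF//= subr_eq0 gt_eqF.
have := conjugate_powR a0 (powR_ge0 b (p - 1)) p0 q0 pq.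
rewrite -powRrM (_ : (p - 1) * (p / (p - 1)) = p); last first.
  by field; rewrite subr_eq0 gt_eqF.
rewrite -(ler_pM2l p0) => /le_trans; rewrite (mulrC a); apply.
rewrite le_eqVlt; apply/orP; left; apply/eqP; field.
by rewrite subr_eq0 !gt_eqF.
Qed.
End tangent.

Section jensen.
Context d (T : measurableType d) (R : realType) (mu : {measure set T -> \bar R}).
Variables (Q : set T) (p : R).
Hypotheses (mQ : measurable Q) (Q0 : (0 < mu Q)%E) (Qoo : (mu Q < +oo)%E) (p1 : 1 < p).

Let m := fine (mu Q).
Let m0 : 0 < m. Proof. by rewrite fine_gt0// Q0. Qed.

Lemma integrable_cst_on r : mu.-integrable Q (EFin \o cst r).
Proof.
apply: measurable_bounded_integrable => //.
by exists `|r|; split; [exact: num_real|move=> x rx y _ /=; exact: ltW].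
Qed.

(** Integrate the tangent inequality at the mean [b] over [Q]: since the integral of [f] is [b * m],
    the multiples of [m] times b^p leave exactly one copy on the left. *)
Lemma jensen_powR (f : T -> R) : measurable_fun setT f -> (forall x, 0 <= f x) ->
  mu.-integrable Q (EFin \o f) ->
  ((m * ((\int[mu]_(x in Q) f x) / m) `^ p)%:E <= \int[mu]_(x in Q) (f x `^ p)%:E)%E.
Proof.
move=> mf f0 intf; set a := Rintegral _ _ _; set b := a / m.
have p0 : 0 < p by exact: lt_trans p1.
have a0 : 0 <= a by apply: Rintegral_ge0.
have b0 : 0 <= b by rewrite divr_ge0// ltW.
have mfp : measurable_fun Q (fun x => f x `^ p).
  by apply: measurable_funTS; exact: (@measurableT_comp _ _ _ _ _ _ (@powR R ^~ p)).
have [->|Joo] := eqVneq (\int[mu]_(x in Q) (f x `^ p)%:E)%E +oo%E; first exact: leey.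
have J0 : (0 <= \int[mu]_(x in Q) (f x `^ p)%:E)%E.
  by apply: integral_ge0 => x _; rewrite lee_fin powR_ge0.
have intfp : mu.-integrable Q (EFin \o (fun x => f x `^ p)).
  apply/integrableP; split; first exact/measurable_EFinP.
  rewrite (eq_integral (fun x => (f x `^ p)%:E)) ?ltey// => x _ /=.
  by rewrite ger0_norm// powR_ge0.
have Jfin : (\int[mu]_(x in Q) (f x `^ p)%:E)%E \is a fin_num.
  by rewrite ge0_fin_numE// ltey.
rewrite -(fineK Jfin) lee_fin.
have : \int[mu]_(x in Q) (p * b `^ (p - 1) * f x) <=
       \int[mu]_(x in Q) (f x `^ p + (p - 1) * b `^ p).
  apply: le_Rintegral => //.
  - have := integrableZl mQ (p * b `^ (p - 1)) intf.
    by apply: eq_integrable => // x _ /=.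
  - have := integrableD mQ intfp (integrable_cst_on ((p - 1) * b `^ p)).
    by apply: eq_integrable => // x _ /=.
  by move=> x _; rewrite -mulrA powR_tangent.
rewrite RintegralZl// RintegralD//; last exact: integrable_cst_on.
rewrite Rintegral_cst// -/a -/m.
have -> : a = b * m by rewrite /b divfK// gt_eqF.
have -> : p * b `^ (p - 1) * (b * m) = p * m * b `^ p.
  by rewrite -(mulr_powRB1 b0 p0); ring.
rewrite /Rintegral; set J := fine _; lra.
Qed.

Definition average (v : T -> R) := (\int[mu]_(x in Q) v x) / m.

Section averages.
Variable v : T -> R.
Hypotheses (mv : measurable_fun setT v) (intv : mu.-integrable Q (EFin \o v)).

Lemma integrable_dist (t : R) : mu.-integrable Q (EFin \o (fun x => `|t - v x|)).
Proof.
have := integrable_abse (integrableB mQ (integrable_cst_on t) intv).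
exact: eq_integrable.
Qed.

Lemma measurable_dist (t : R) : measurable_fun setT (fun x => `|t - v x|).
Proof. by apply: measurableT_comp => //; exact: measurable_funB. Qed.

Lemma dist_average_le (t : R) : `|t - average v| <= (\int[mu]_(x in Q) `|t - v x|) / m.
Proof.
rewrite ler_pdivlMr// -[X in _ * X](gtr0_norm m0) -normrM.
have -> : (t - average v) * m = \int[mu]_(x in Q) (t - v x).
  rewrite RintegralB//; last exact: integrable_cst_on.
  by rewrite Rintegral_cst// /average mulrBl divfK ?gt_eqF.
apply: le_normr_Rintegral => //.
have := integrableB mQ (integrable_cst_on t) intv.
exact: eq_integrable.
Qed.

Lemma jensen_dist (t : R) :
  ((m * `|t - average v| `^ p)%:E <= \int[mu]_(x in Q) (`|t - v x| `^ p)%:E)%E.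
Proof.
apply: le_trans (jensen_powR (measurable_dist t) _ (integrable_dist t)) => //.
rewrite lee_fin ler_pM2l// ge0_ler_powR ?nnegrE//.
- by rewrite ltW// (lt_trans _ p1).
- by apply: divr_ge0; [exact: Rintegral_ge0|exact: ltW].
exact: dist_average_le.
Qed.
End averages.
End jensen.

(** * Comparison of iterated and Lebesgue integrals off a null set *)

Section iint_ae.
Variables (R : realType) (n : nat) (mu : {measure set (rVb R n) -> \bar R}).
Hypothesis mu_iint : forall f : rVb R n -> \bar R, measurable_fun setT f ->
  (forall x, 0 <= f x)%E -> iint f = (\int[mu]_x f x)%E.
Variable N : set (rVb R n).
Hypotheses (mN : measurable N) (N0 : mu N = 0%E).
Local Open Scope ereal_scope.

Let measurable_memN : measurable_fun setT (fun x : rVb R n => x \in N).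
Proof.
apply: (measurable_fun_bool true).
rewrite [X in measurable X](_ : _ = N) ?setTI//; apply/seteqP; split=> x /=.
  by move/set_mem.
by move=> Nx; exact: mem_set.
Qed.

Let integral_off_null (f g : rVb R n -> \bar R) :
  measurable_fun setT f -> measurable_fun setT g ->
  (forall x, 0 <= f x) -> (forall x, 0 <= g x) -> (forall x, ~ N x -> f x = g x) ->
  \int[mu]_x f x = \int[mu]_x g x.
Proof.
move=> mf mg f0 g0 fg; apply: ge0_ae_eq_integral => //.
exists N; split => // x /= /not_implyP[_ nfg]; apply: contrapT => /fg.
by [].
Qed.

(** Here [f] is arbitrary. Raising [g] to +oo on [N] gives a Borel majorant of [f] with the same
    integral as [g]. The reverse bound [le_iint_ae] lowers [g] to 0 on [N] instead. *)
Lemma iint_le_ae (f g : rVb R n -> \bar R) : measurable_fun setT g ->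
  (forall x, 0 <= f x) -> (forall x, 0 <= g x) -> (forall x, ~ N x -> f x <= g x) ->
  iint f <= \int[mu]_x g x.
Proof.
move=> mg f0 g0 fg; pose h x := if x \in N then +oo else g x.
have mh : measurable_fun setT h.
  exact: measurable_fun_ifT.
have h0 x : 0 <= h x by rewrite /h; case: ifP.
rewrite (@integral_off_null g h)//; last first.
  by move=> x Nx; rewrite /h memNset.
rewrite -mu_iint//; apply: le_iint => // x; rewrite /h.
by case: (boolP (x \in N)) => [_|/negP nN]; [exact: leey|apply: fg => Nx; apply: nN; exact: mem_set].
Qed.

Lemma le_iint_ae (f g : rVb R n -> \bar R) : measurable_fun setT g ->
  (forall x, 0 <= f x) -> (forall x, 0 <= g x) -> (forall x, ~ N x -> g x <= f x) ->
  \int[mu]_x g x <= iint f.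
Proof.
move=> mg f0 g0 gf; pose h x := if x \in N then 0 else g x.
have mh : measurable_fun setT h.
  exact: measurable_fun_ifT.
have h0 x : 0 <= h x by rewrite /h; case: ifP.
rewrite (@integral_off_null g h)//; last first.
  by move=> x Nx; rewrite /h memNset.
rewrite -mu_iint//; apply: le_iint => // x; rewrite /h.
by case: (boolP (x \in N)) => [//|/negP nN]; apply: gf => Nx; apply: nN; exact: mem_set.
Qed.

Lemma iint_eq_ae (f g : rVb R n -> \bar R) : measurable_fun setT g ->
  (forall x, 0 <= f x) -> (forall x, 0 <= g x) -> (forall x, ~ N x -> f x = g x) ->
  iint f = \int[mu]_x g x.
Proof.
move=> mg f0 g0 fg; apply/eqP; rewrite eq_le; apply/andP; split.
  by apply: iint_le_ae => // x /fg ->.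
by apply: le_iint_ae => // x /fg ->.
Qed.

End iint_ae.

(** * Lower bounds for the energy of a pair of cubes *)

Section local_estimate.
Variables (R : realType) (n : nat) (mu : {measure set (rVb R n) -> \bar R}).
Hypothesis mu_iint : forall f : rVb R n -> \bar R, measurable_fun setT f ->
  (forall x, 0 <= f x)%E -> iint f = (\int[mu]_x f x)%E.
Variable N : set (rVb R n).
Hypotheses (mN : measurable N) (N0 : mu N = 0%E).
Variables (u v : rVb R n -> R) (p : R).
Hypotheses (mv : measurable_fun setT v) (p1 : 1 < p).

Lemma measurable_dist_powR (t : R) :
  measurable_fun setT (fun x => `|t - v x| `^ p).
Proof.
by apply: (@measurableT_comp _ _ _ _ _ _ (@powR R ^~ p)) => //; exact: measurable_dist.
Qed.

Lemma inner_estimate (B Q' : set (rVb R n)) (x : rVb R n) (a rho : R) :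
  measurable Q' -> 0 < a -> (forall y, Q' y -> B y /\ enorm (x - y) <= rho) ->
  v x = u x -> (forall y, Q' y -> ~ N y -> v y = u y) ->
  (((rho `^ a)^-1)%:E * \int[mu]_(y in Q') (`|v x - v y| `^ p)%:E <=
   iint (fun y => (\1_B y * (`|u x - u y| `^ p / enorm (x - y) `^ a))%:E))%E.
Proof.
move=> mQ' a0 Q'B vx vy; have p0 : 0 < p by exact: lt_trans p1.
have k0 : 0 <= (rho `^ a)^-1 by rewrite invr_ge0 powR_ge0.
have mg : measurable_fun setT (fun y : rVb R n => (`|v x - v y| `^ p)%:E).
  by apply/measurable_EFinP; exact: measurable_dist_powR.
have gge0 y : (0 <= (`|v x - v y| `^ p)%:E)%E by rewrite lee_fin powR_ge0.
rewrite -ge0_integralZl//; last exact: measurable_funTS.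
rewrite integral_mkcond; apply: (le_iint_ae mu_iint mN N0) => [|y|y|y Ny].
- apply: (measurable_restrictT _ mQ').1; apply: measurable_funTS.
  exact: measurable_funeM.
- by rewrite lee_fin mulr_ge0// divr_ge0 ?powR_ge0.
- by apply: erestrict_ge0 => z _; rewrite mule_ge0.
rewrite patchE; case: ifPn => [/set_mem Qy|_]; last first.
  by rewrite lee_fin mulr_ge0// divr_ge0 ?powR_ge0.
have [By xyr] := Q'B y Qy; rewrite -EFinM lee_fin indicE mem_set// mul1r vx vy//.
(* Equal values make both sides 0; otherwise [x] and [y] differ, so the denominator is positive and
   inverses can be compared. *)
have [uxy|uxy] := eqVneq (u x) (u y).
  by rewrite uxy subrr normr0 powR0 ?gt_eqF// mulr0 mul0r.
have xy : 0 < enorm (x - y).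
  rewrite lt_def enorm_ge0 andbT; apply: contra uxy => /eqP xy0; apply/eqP; congr u.
  apply/rowP => i; apply/eqP; rewrite -subr_eq0 -normr_le0 -xy0.
  by have := coord_le_enorm (x - y) i; rewrite !mxE.
rewrite mulrC ler_wpM2l ?powR_ge0// lef_pV2 ?posrE ?powR_gt0//; last exact: lt_le_trans xyr.
by rewrite ge0_ler_powR ?nnegrE ?(ltW a0) ?(ltW xy)// (le_trans (ltW xy)).
Qed.

(** Jensen's inequality is applied twice, on [Q'] for fixed [x] and then on [Q]. The inner integral
    enters only through a pointwise lower bound, so [K] can be any nonnegative function satisfying
    it. *)
Lemma outer_estimate (Q Q' : set (rVb R n)) (K : rVb R n -> \bar R) (k : R) :
  measurable Q -> (0 < mu Q)%E -> (mu Q < +oo)%E ->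
  measurable Q' -> (0 < mu Q')%E -> (mu Q' < +oo)%E ->
  mu.-integrable Q (EFin \o v) -> mu.-integrable Q' (EFin \o v) ->
  0 <= k -> (forall x, 0 <= K x)%E ->
  (forall x, Q x -> ~ N x -> (k%:E * \int[mu]_(y in Q') (`|v x - v y| `^ p)%:E <= K x)%E) ->
  ((k * fine (mu Q') * (fine (mu Q) *
     ((\int[mu]_(x in Q) `|v x - average mu Q' v|) / fine (mu Q)) `^ p))%:E <=
   iint (fun x => (\1_Q x)%:E * K x))%E.
Proof.
move=> mQ Q0 Qoo mQ' Q'0 Q'oo iQ iQ' k0 K0 kK.
set a := average mu Q' v; set m' := fine (mu Q').
have m'0 : 0 <= m' by rewrite fine_ge0.
have mg : measurable_fun setT (fun y : rVb R n => (`|a - v y| `^ p)%:E).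
  by apply/measurable_EFinP; exact: measurable_dist_powR.
have gge0 y : (0 <= (`|a - v y| `^ p)%:E)%E by rewrite lee_fin powR_ge0.
apply: le_trans (_ : (k * m')%:E * \int[mu]_(x in Q) (`|a - v x| `^ p)%:E <= _)%E.
  rewrite EFinM lee_wpmul2l ?lee_fin ?mulr_ge0//.
  under [X in X / _]eq_Rintegral do rewrite distrC.
  apply: (jensen_powR mQ Q0 Qoo p1) => //; first exact: measurable_dist.
  exact: integrable_dist.
rewrite -ge0_integralZl// ?lee_fin ?mulr_ge0//; last exact: measurable_funTS.
rewrite integral_mkcond; apply: (le_iint_ae mu_iint mN N0) => [|x|x|x Nx].
- apply: (measurable_restrictT _ mQ).1; apply: measurable_funTS.
  exact: measurable_funeM.
- by rewrite mule_ge0// lee_fin.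
- by apply: erestrict_ge0 => z _; rewrite mule_ge0// lee_fin mulr_ge0.
rewrite patchE; case: ifPn => [/set_mem Qx|_]; last by rewrite mule_ge0// lee_fin.
rewrite indicE mem_set// mul1e; apply: le_trans (kK x Qx Nx).
rewrite EFinM -muleA lee_wpmul2l ?lee_fin// -EFinM distrC.
exact: jensen_dist.
Qed.
End local_estimate.

(** * Summation over chains *)
Section chain_sum.
Variables (R : realType) (I : eqType).

(** Write b x = E (x / (E H)) (b H) and apply Young's inequality with exponents p and p / (p - 1) to
    the p-th roots of the last two factors; the coefficients, being at most 1, are dropped. *)
Lemma young_weighted (p b H x E : R) : 1 < p -> 0 <= b -> 0 < H -> 0 <= x -> 0 < E ->
  (b * x) `^ p^-1 <= E `^ p^-1 * (x / (E * H) + (b * H) `^ (p - 1)^-1).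
Proof.
move=> p1 b0 H0 x0 E0; have p0 : 0 < p by exact: lt_trans p1.
have q0 : 0 < p / (p - 1) by rewrite divr_gt0// subr_gt0.
have p1' : p - 1 != 0 by rewrite subr_eq0 gt_eqF.
have pq : p^-1 + (p / (p - 1))^-1 = 1.
  by rewrite invf_div; field; rewrite gt_eqF.
have EH0 : 0 < E * H by exact: mulr_gt0.
have xE0 : 0 <= x / (E * H) by rewrite divr_ge0// ltW.
have bH0 : 0 <= b * H by rewrite mulr_ge0// ltW.
have -> : b * x = E * ((x / (E * H)) * (b * H)) by field; rewrite !gt_eqF.
rewrite powRM; [|exact: ltW|exact: mulr_ge0].
apply: ler_wpM2l; first exact: powR_ge0.
rewrite powRM//.
apply: le_trans (conjugate_powR (powR_ge0 _ _) (powR_ge0 _ _) p0 q0 pq) _.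
rewrite -!powRrM mulVf ?gt_eqF// powRr1//.
have -> : p^-1 * (p / (p - 1)) = (p - 1)^-1 by field; rewrite p1' gt_eqF.
have Dq : 1 <= p / (p - 1) by rewrite ler_pdivlMr ?subr_gt0//; lra.
by apply: lerD; rewrite ler_piMr ?powR_ge0// invf_le1// ltW.
Qed.

Variables (lev : I -> nat) (S : seq I) (C : I -> seq I) (V e : I -> R).
Variables (p E M1 M2 : R) (b H w : nat -> R).

(* Young's inequality with the level weights H replaces each b * e by a multiple of e / H,
   summed over the starting cubes q first, plus a quantity depending on the level only. *)
Lemma chain_sum : 1 < p -> 0 < E -> 0 <= M1 ->
  (forall q, 0 <= V q) -> (forall r, 0 <= e r) -> (forall j, 0 <= b j) ->
  (forall j, 0 < H j) ->
  (forall q, q \in S -> uniq (C q)) ->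
  (forall r, \sum_(q <- S | r \in C q) V q <= M1 * H (lev r)) ->
  (forall j, \sum_(q <- S) V q * (count (fun r => lev r == j) (C q))%:R <= w j) ->
  (forall T, uniq T -> {subset T <= flatten (map C S)} -> \sum_(r <- T) e r <= E) ->
  (forall J, \sum_(j < J) (b j * H j) `^ (p - 1)^-1 * w j <= M2) ->
  \sum_(q <- S) V q * (\sum_(r <- C q) (b (lev r) * e r) `^ p^-1)
    <= (M1 + M2) * E `^ p^-1.
Proof.
move=> p1 E0 M10 V0 e0 b0 H0 CU F1 F2 F3 F4.
pose g j := (b j * H j) `^ (p - 1)^-1.
apply: le_trans (_ : \sum_(q <- S) V q * (\sum_(r <- C q)
   (E `^ p^-1 * (e r / (E * H (lev r)) + g (lev r)))) <= _).
  apply: ler_sum => q _; rewrite ler_wpM2l//; apply: ler_sum => r _.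
  exact: young_weighted.
under eq_bigr do rewrite -mulr_sumr big_split/= mulrCA mulrDr.
rewrite -mulr_sumr mulrC ler_wpM2r ?powR_ge0// big_split/=; apply: lerD.
  (* All cubes on the chains. Summing over starting cubes first cancels the weight [H] and leaves
     [M1 / E] times each energy; the energies of distinct cubes add up to at most [E]. *)
  pose T := undup (flatten (map C S)).
  have CT q F : q \in S -> \sum_(r <- C q) F r = \sum_(r <- T | r \in C q) F r :> R.
    move=> qS; rewrite -[RHS]big_filter; apply: perm_big; apply: uniq_perm.
    - exact: CU.
    - by rewrite filter_uniq// undup_uniq.
    move=> r; rewrite mem_filter mem_undup; case: (boolP (r \in C q)) => //= rq.
    by apply/esym/flatten_mapP; exists q.
  rewrite big_seq_cond (eq_bigr (fun q => \sum_(r <- T | r \in C q) V q * (e r / (E * H (lev r)))));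
    last by move=> q /andP[qS _]; rewrite CT// mulr_sumr.
  rewrite -big_seq_cond (exchange_big_dep predT)//=.
  apply: le_trans (_ : \sum_(r <- T) M1 / E * e r <= _).
    apply: ler_sum => r _; rewrite -mulr_suml.
    apply: le_trans (_ : M1 * H (lev r) * (e r / (E * H (lev r))) <= _).
      by rewrite ler_wpM2r// divr_ge0// mulr_ge0 ?ltW.
    by rewrite le_eqVlt; apply/orP; left; apply/eqP; field; rewrite !gt_eqF.
  rewrite -mulr_sumr -[leRHS](divfK (lt0r_neq0 E0)) ler_wpM2l ?divr_ge0 ?(ltW E0)//.
  by apply: F3; [exact: undup_uniq|move=> r; rewrite mem_undup].
(* Larger than every level that occurs, so that chain sums can be sorted by level; the bound [M2] is
   uniform in [J]. *)
pose J := (\max_(r <- flatten (map C S)) lev r).+1.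
have gC q : q \in S -> \sum_(r <- C q) g (lev r) =
    \sum_(j < J) g j * (count (fun r => lev r == j) (C q))%:R.
  move=> qS; transitivity (\sum_(r <- C q) \sum_(j < J) (if lev r == j then g j else 0)).
    rewrite big_seq [RHS]big_seq; apply: eq_bigr => r rq.
    have rJ : (lev r < J)%N.
      by rewrite ltnS; apply: leq_bigmax_seq => //; apply/flatten_mapP; exists q.
    rewrite (bigD1 (Ordinal rJ))//= eqxx big1 ?addr0// => j jr; case: eqP => // E1.
    by case/eqP: jr; apply: val_inj.
  rewrite exchange_big/=; apply: eq_bigr => j _.
  by rewrite -big_mkcond/= -sum1_count natr_sum mulr_sumr; apply: eq_bigr => r _; rewrite mulr1.
rewrite big_seq_cond (eq_bigr (fun q => \sum_(j < J) g j * (V q * (count (fun r => lev r == j) (C q))%:R)));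
  last by move=> q /andP[qS _]; rewrite gC// mulr_sumr; apply: eq_bigr => j _; rewrite mulrCA.
rewrite -big_seq_cond exchange_big/=; apply: le_trans (F4 J); apply: ler_sum => j _.
by rewrite -mulr_sumr ler_wpM2l ?powR_ge0.
Qed.
End chain_sum.

(** * Exponents: where the conditions on [s] and [p] enter *)

Section exponents.
Variable R : realType.

Lemma geometric_sum_le (theta : R) J : 0 <= theta < 1 ->
  \sum_(j < J) theta ^+ j <= (1 - theta)^-1.
Proof.
move=> /andP[t0 t1]; have t1' : 0 < 1 - theta by rewrite subr_gt0.
rewrite -[leRHS]mul1r ler_pdivlMr//.
have -> : (\sum_(j < J) theta ^+ j) * (1 - theta) = 1 - theta ^+ J.
  elim: J => [|J ih]; first by rewrite big_ord0 mul0r expr0 subrr.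
  by rewrite big_ord_recr/= mulrDl ih exprS; ring.
by rewrite lerBlDr lerDl exprn_ge0.
Qed.

(** Every factor is a constant times a power of 2^-j, so the sum is geometric with ratio 2^-beta;
    the lower bound on [p] says exactly that [beta] is positive. *)
Lemma shadow_sum (n : nat) (s p lam delta C1 C4 : R) :
  1 < s -> 1 < p -> 0 <= C1 -> 0 <= C4 ->
  0 < n%:R - s * (1 - delta) - lam + 1 ->
  (s * (n%:R - 1) - lam + 1) / (n%:R - s * (1 - delta) - lam + 1) < p ->
  exists M, forall J, \sum_(j < J)
    (C1 * dyadic_side R j `^ (delta * p - n%:R) * shadow_radius s j ^+ n) `^ (p - 1)^-1 *
    (C4 * (shadow_radius s j / dyadic_side R j * shadow_radius s j `^ (n%:R - lam))) <= M.
Proof.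
move=> s1 p1 C10 C40 den0; rewrite ltr_pdivrMr// => hp.
have s0 : 0 < s by exact: lt_trans s1.
have p10 : 0 < p - 1 by rewrite subr_gt0.
have h2 : 0 < (2^-1 : R) by rewrite invr_gt0.
pose beta := (delta * p - n%:R + s^-1 * n%:R) / (p - 1) + (s^-1 + - 1 + s^-1 * (n%:R - lam)).
have beta0 : 0 < beta.
  have -> : beta = (p * (n%:R - s * (1 - delta) - lam + 1) - (s * (n%:R - 1) - lam + 1)) / (s * (p - 1)).
    by rewrite /beta; field; rewrite !gt_eqF.
  by rewrite divr_gt0 ?mulr_gt0// subr_gt0.
pose theta := 2^-1 `^ beta : R.
have theta1 : 0 <= theta < 1.
  rewrite powR_ge0/=; have -> : 1 = 1 `^ beta :> R by rewrite powR1.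
  by rewrite gt0_ltr_powR ?nnegrE ?(ltW h2)// invf_lt1 ?ltr1n.
have E j : (C1 * dyadic_side R j `^ (delta * p - n%:R) * shadow_radius s j ^+ n) `^ (p - 1)^-1 *
    (C4 * (shadow_radius s j / dyadic_side R j * shadow_radius s j `^ (n%:R - lam))) =
    C1 `^ (p - 1)^-1 * C4 * theta ^+ j.
  have l0 := dyadic_side_gt0 R j; have l0' := lt0r_neq0 l0.
  rewrite -[in LHS]powR_mulrn ?powR_ge0//.
  rewrite -[X in _ * (_ / X * _)]powRr1 ?(ltW l0)// -powRN.
  rewrite /shadow_radius -!powRrM -mulrA -powRD ?l0' ?implybT//.
  rewrite powRM ?powR_ge0// -powRrM -!powRD ?l0' ?implybT//.
  rewrite mulrACA -powRD ?l0' ?implybT//.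
  rewrite -/beta; congr (_ * _).
  have -> : dyadic_side R j = 2^-1 `^ j%:R by rewrite powR_mulrn ?(ltW h2).
  have -> : theta ^+ j = theta `^ j%:R by rewrite powR_mulrn ?powR_ge0.
  exact: powRAC.
exists (C1 `^ (p - 1)^-1 * C4 * (1 - theta)^-1) => J.
under eq_bigr do rewrite E.
by rewrite -mulr_sumr ler_wpM2l ?mulr_ge0 ?powR_ge0// geometric_sum_le.
Qed.

(** The upper Minkowski dimension controls volumes of neighbourhoods only for exponents above [lam].
    All conditions being strict, they survive a small increase of [lam]. *)
Lemma perturb_exponent (n : nat) (s p lam delta : R) :
  1 < s -> 0 < delta -> delta < 1 -> lam < n%:R ->
  s < (n%:R + 1 - lam) / (1 - delta) ->
  (s * (n%:R - 1) - lam + 1) / (n%:R - s * (1 - delta) - lam + 1) < p -> 1 < p ->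
  exists lam', [/\ lam < lam', lam' < n%:R,
    0 < n%:R - s * (1 - delta) - lam' + 1 &
    (s * (n%:R - 1) - lam' + 1) / (n%:R - s * (1 - delta) - lam' + 1) < p].
Proof.
move=> s1 d0 d1 ln; have d10 : 0 < 1 - delta by rewrite subr_gt0.
rewrite ltr_pdivlMr// => hs.
set den := n%:R - s * (1 - delta) - lam + 1.
have den0 : 0 < den by rewrite /den; lra.
rewrite ltr_pdivrMr// => hp p1.
set gap := p * den - (s * (n%:R - 1) - lam + 1).
have gap0 : 0 < gap by rewrite subr_gt0.
(* The three bounds keep, in turn, the denominator positive, [lam + eps] below [n], and the
   inequality for [p], whose slack after clearing the denominator is [gap]. *)
pose eps := Num.min (Num.min (den / 2) ((n%:R - lam) / 2)) (gap / (2 * p)).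
have p0 : 0 < p by exact: lt_trans p1.
have eps0 : 0 < eps by rewrite !lt_min !divr_gt0 ?mulr_gt0// subr_gt0.
have e1 : eps <= den / 2 by rewrite !ge_min lexx.
have e2 : eps <= (n%:R - lam) / 2 by rewrite !ge_min lexx orbT.
have e3 : eps <= gap / (2 * p) by rewrite !ge_min lexx !orbT.
have den' : 0 < n%:R - s * (1 - delta) - (lam + eps) + 1 by rewrite /den in e1 den0; lra.
exists (lam + eps); split => //.
- by rewrite ltrDl.
- by lra.
rewrite ltr_pdivrMr//; rewrite ler_pdivlMr ?mulr_gt0// in e3.
rewrite /gap /den in gap0 e3; nra.
Qed.
End exponents.

(** * Neighbourhoods of the boundary *)
Section minkowski.
Variables (R : realType) (n : nat).
Implicit Types (G E : set 'rV[R]_n).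

Lemma boundary_bounded G M : (forall x, G x -> enorm x <= M) ->
  forall e, boundary G e -> enorm e <= M + 1.
Proof.
move=> GM e [ce _].
(* This max-norm radius gives a Euclidean distance of at most n/(n+1). *)
have r0 : 0 < n.+1%:R^-1 :> R by rewrite invr_gt0.
have [y [Gy [_ yx]]] := ce _ (nbhsx_ballx e _ r0).
rewrite -[e](subrK y) addrC; apply: le_trans (enormD _ _) _; apply: lerD; first exact: GM.
apply: le_trans (enorm_le_coord (r := n.+1%:R^-1) _) _.
  by move=> i; have /ltW := yx ord0 i; rewrite !mxE.
by rewrite ler_pdivrMr// mul1r ler_nat.
Qed.

(** The enclosing box has half-width [2 * r] because [rVbox] is half-open, so that [r] itself could
    miss points. *)
Lemma vol_bounded_le (A : set 'rV[R]_n) (z : 'rV[R]_n) (r : R) : 0 < r ->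
  (forall y, A y -> enorm (y - z) <= r) -> (vol A <= ((4 * r) ^+ n)%:E)%E.
Proof.
move=> r0 Ar.
have -> : ((4 * r) ^+ n)%:E = vol (rVbox (\row_i (z ord0 i - 2 * r)) (\row_i (z ord0 i + 2 * r))).
  rewrite /vol iint_rVbox => [|i]; last by rewrite !mxE; lra.
  congr EFin; rewrite (eq_bigr (fun=> 4 * r)) ?prodr_const ?card_ord// => i _.
  by rewrite !mxE; lra.
apply: le_iint => x; rewrite !indicE lee_fin//.
case: (boolP (x \in A)) => // /set_mem Ax.
rewrite mem_set// => i; have := le_trans (coord_le_enorm _ i) (Ar x Ax).
by rewrite !mxE ler_norml => /andP[h1 h2]; apply/andP; split; lra.
Qed.

(** As [lam'] exceeds the supremum defining [dimM], the upper limit at [lam'] is finite, and so is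
    the supremum over some right neighbourhood of 0. *)
Lemma dimM_lt_bound E (lam lam' : R) : 0 <= lam' -> lam < lam' ->
  (dimM E <= lam%:E)%E ->
  exists M eps : R, [/\ 0 <= M, 0 < eps & forall r, 0 < r -> r < eps ->
    (vol (rneigh E r) <= (M * r `^ (n%:R - lam'))%:E)%E].
Proof.
move=> l0 ll dE; set f := fun r : R => (vol (rneigh E r) * (r `^ (lam' - n%:R))%:E)%E.
have vol0 r : (0 <= vol (rneigh E r))%E by apply: iint_ge0 => x; rewrite lee_fin.
have f0 r : (0 <= f r)%E by rewrite mule_ge0// lee_fin powR_ge0.
have : limf_esup f (0^'+) != +oo%E.
  apply: contraTN ll => /eqP lf; rewrite -leNgt -lee_fin; apply: le_trans dE.
  by apply: ereal_sup_ubound; exists lam'.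
rewrite -ltey => /ereal_inf_lt[_ [V V0 <-]] supV.
have [e /= e0 eV] := V0.
have supV' r : 0 < r -> r < e -> (f r <= ereal_sup (f @` V))%E.
  move=> r0 re; apply: ereal_sup_ubound; exists r => //; apply: eV => //=.
  by rewrite sub0r normrN gtr0_norm.
have supV0 : (0 <= ereal_sup (f @` V))%E.
  apply: le_trans (f0 (e / 2)) (supV' _ _ _); first by rewrite divr_gt0.
  by rewrite ltr_pdivrMr// ltr_pMr// ltr1n.
exists (fine (ereal_sup (f @` V))), e; split => //; first exact: fine_ge0.
move=> r r0 re; rewrite EFinM fineK ?ge0_fin_numE//.
have -> : vol (rneigh E r) = (f r * (r `^ (n%:R - lam'))%:E)%E.
  rewrite /f -muleA -EFinM -powRD; last by rewrite (gt_eqF r0) implybT.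
  by rewrite (_ : lam' - n%:R + _ = 0) ?powRr0 ?mule1//; ring.
by rewrite lee_wpmul2r ?lee_fin ?powR_ge0// supV'.
Qed.

(** Small radii are handled by [dimM_lt_bound]. Once B h >= eps, the neighbourhood lies in a fixed
    ball, of volume at most [D], and h >= eps / B bounds the power of h from below. *)
Lemma minkowski_bound G (Mb lam lam' B : R) : (forall x, G x -> enorm x <= Mb) ->
  0 <= lam' -> lam < lam' -> lam' < n%:R -> (dimM (boundary G) <= lam%:E)%E -> 0 < B ->
  exists C : R, 0 <= C /\ forall h, 0 < h -> h <= 1 ->
    (vol (rneigh (boundary G) (B * h)) <= (C * h `^ (n%:R - lam'))%:E)%E.
Proof.
move=> GM l0 ll ln dE B0; have [M [eps [M0 eps0 Mr]]] := dimM_lt_bound l0 ll dE.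
have nl0 : 0 <= n%:R - lam' by rewrite subr_ge0 ltW.
set t := n%:R - lam'.
pose D := (4 * (`|Mb| + 1 + B)) ^+ n.
have D0 : 0 <= D by rewrite exprn_ge0// mulr_ge0// !addr_ge0// ltW.
exists (M * B `^ t + D / (eps / B) `^ t); split.
  by apply: addr_ge0; [apply: mulr_ge0|apply: divr_ge0] => //; exact: powR_ge0.
move=> h h0 h1; rewrite mulrDl EFinD.
have [Bh|Bh] := ltP (B * h) eps.
  apply: le_trans (Mr _ _ Bh) _; first exact: mulr_gt0.
  by rewrite -EFinD lee_fin powRM ?(ltW B0) ?(ltW h0)// mulrA lerDl mulr_ge0 ?divr_ge0 ?powR_ge0.
apply: le_trans (_ : D%:E <= _)%E.
  apply: (@vol_bounded_le _ 0); first by have := normr_ge0 Mb; lra.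
  move=> y [e Ee ye]; rewrite subr0 -[y](subrK e) addrC.
  apply: le_trans (enormD _ _) _; apply: lerD.
    by apply: le_trans (boundary_bounded GM Ee) _; rewrite lerD2r ler_norm.
  by apply: le_trans (ltW ye) _; rewrite ler_piMr// ltW.
rewrite -EFinD lee_fin -[leLHS]add0r; apply: lerD.
  by rewrite -mulrA mulr_ge0// mulr_ge0 ?powR_ge0.
rewrite mulrAC ler_pdivlMr ?powR_gt0 ?divr_gt0// ler_wpM2l//.
by rewrite ge0_ler_powR ?nnegrE ?(ltW h0) ?divr_ge0 ?(ltW eps0) ?(ltW B0)// ler_pdivrMr// mulrC.
Qed.
End minkowski.

(** * The Poincare estimate *)
Section whitney_poincare.
Variables (R : realType) (n : nat) (mu : {measure set (rVb R n) -> \bar R}).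
Hypothesis mu_iint : forall f : rVb R n -> \bar R, measurable_fun setT f ->
  (forall x, 0 <= f x)%E -> iint f = (\int[mu]_x f x)%E.
Variables (G : set 'rV[R]_n) (wq : 'rV[R]_n -> nat * 'rV[int]_n) (p delta tau A : R).
Hypotheses (n0 : (0 < n)%N) (p1 : 1 < p) (delta0 : 0 < delta).
Hypotheses (tau0 : 0 < tau) (tau1 : tau < 1) (A0 : 0 < A) (bG : boundary G !=set0) (oG : open G).
Hypothesis wqP : forall x, G x -> [/\ dyadic_cube (wq x) x,
     forall y, dyadic_cube (wq x) y -> G y /\ wq y = wq x,
     16 * n%:R / tau * dyadic_side R (wq x).1 <= dist_to x (boundary G) &
     dist_to x (boundary G) <= A * dyadic_side R (wq x).1].
Variable (N : set (rVb R n)) (u v : rVb R n -> R).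
Hypotheses (mN : measurable N) (N0 : mu N = 0%E) (mv : measurable_fun setT v).
Hypothesis vint : mu.-integrable setT (EFin \o v).
Hypothesis vu : forall x, G x -> ~ N x -> v x = u x.

Let d x := dist_to x (boundary G).
Let cube q : set (rVb R n) := dyadic_cube q.
Let l (q : nat * 'rV[int]_n) := dyadic_side R q.1.
Let K := 16 * n%:R / tau.
Let sel (q : nat * 'rV[int]_n) := exists2 z, G z & q = wq z.

Definition inner_energy x := iint (fun y : 'rV[R]_n =>
  (\1_(G `&` eball x (tau * dist_to x (boundary G))) y *
    (`|u x - u y| `^ p / enorm (x - y) `^ (n%:R + delta * p)))%:E).

Definition cube_energy q := iint (fun x : 'rV[R]_n => (\1_(cube q) x)%:E * inner_energy x)%E.

(** The numerator comes from |x - y| <= A [l q] in the kernel, the denominator from the least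
    possible ratio of the sides of admissible cubes. *)
Definition edge_const := A `^ (n%:R + delta * p) / ((1 - tau) * K / A) ^+ n.

Definition edge_bound q :=
  (edge_const * l q `^ (delta * p - n%:R) * fine (cube_energy q)) `^ p^-1.

Let av q := average mu (cube q) v.

Lemma inner_energy_ge0 x : (0 <= inner_energy x)%E.
Proof. by apply: iint_ge0 => y; rewrite lee_fin mulr_ge0// divr_ge0 ?powR_ge0. Qed.

Lemma cube_energy_ge0 q : (0 <= cube_energy q)%E.
Proof. by apply: iint_ge0 => y; rewrite mule_ge0 ?inner_energy_ge0// lee_fin. Qed.

Let l0 q : 0 < l q. Proof. exact: dyadic_side_gt0. Qed.

Let mcube q : measurable (cube q). Proof. exact: measurable_rVbox. Qed.

Let mu_cube q : mu (cube q) = (l q ^+ n)%:E. Proof. exact: mu_dyadic_cube. Qed.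

Let mu_cube0 q : (0 < mu (cube q))%E. Proof. by rewrite mu_cube lte_fin exprn_gt0. Qed.

Let mu_cubeoo q : (mu (cube q) < +oo)%E. Proof. by rewrite mu_cube ltry. Qed.

Let vint_cube q : mu.-integrable (cube q) (EFin \o v).
Proof. exact: integrableS vint. Qed.

Let K0 : 0 < K. Proof. by rewrite divr_gt0// mulr_gt0// ltr0n. Qed.

Let selP q x : sel q -> cube q x -> [/\ G x, wq x = q, K * l q <= d x & d x <= A * l q].
Proof.
move=> [z Gz ->] qx; have [_ wz _ _] := wqP Gz; have [Gx wx] := wz x qx.
by have [_ _] := wqP Gx; rewrite wx.
Qed.

Lemma edge_const_ge0 : 0 <= edge_const.
Proof.
rewrite divr_ge0 ?powR_ge0// exprn_ge0// divr_ge0 ?(ltW A0)// mulr_ge0 ?(ltW K0)//.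
by rewrite subr_ge0 ltW.
Qed.

(** The estimates [inner_estimate] and [outer_estimate] bound the energy of [q] from below; the side
    of [q'] is then replaced by that of [q] and the p-th root is taken. *)
Lemma oscillation_edge q q' : sel q -> sel q' -> whitney_adm G tau q q' ->
  (cube_energy q < +oo)%E ->
  (\int[mu]_(x in cube q) `|v x - av q'|) / l q ^+ n <= edge_bound q.
Proof.
move=> sq sq' /asboolP adm Eoo; set a := n%:R + delta * p.
have p0 : 0 < p by exact: lt_trans p1.
have a0 : 0 < a by rewrite addr_gt0 ?mulr_gt0// ltr0n.
have Al : 0 < A * l q by rewrite mulr_gt0.
pose k := ((A * l q) `^ a)^-1.
have k0 : 0 < k by rewrite invr_gt0 powR_gt0.
set y := _ / _.
have y0 : 0 <= y by rewrite divr_ge0 ?exprn_ge0 ?(ltW (l0 q))//; apply: Rintegral_ge0.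
have est : k * l q' ^+ n * (l q ^+ n * y `^ p) <= fine (cube_energy q).
  rewrite -lee_fin fineK; last by rewrite ge0_fin_numE// cube_energy_ge0.
  have := @outer_estimate R n mu mu_iint N mN N0 v p mv p1 (cube q) (cube q') inner_energy k
    (mcube q) (mu_cube0 q) (mu_cubeoo q) (mcube q') (mu_cube0 q') (mu_cubeoo q')
    (vint_cube q) (vint_cube q') (ltW k0) inner_energy_ge0.
  rewrite !mu_cube/=; apply => x qx Nx.
  have [Gx wx Kx Ax] := selP sq qx.
  apply: (inner_estimate mu_iint mN N0) => //.
  - move=> z qz; have [_ Gz xz] := adm x z qx qz; split.
      by split => //; rewrite /eball/= enormC.
    apply: le_trans (ltW xz) _; apply: le_trans Ax.
    by rewrite ler_piMl ?dist_to_ge0// ltW.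
  - exact: vu.
  - by move=> z qz Nz; apply: vu => //; have [] := adm x z qx qz.
(* For [x] and [z] in the two cubes, d z >= (1 - tau) d x, and both distances are comparable to the
   sides. *)
have ll : (1 - tau) * K / A * l q <= l q'.
  have [x qx] : exists x, cube q x.
    by case: sq => z Gz ->; exists z; have [] := wqP Gz.
  have [z qz] : exists x, cube q' x.
    by case: sq' => z Gz ->; exists z; have [] := wqP Gz.
  have [_ _ Kx _] := selP sq qx; have [_ _ _ Az] := selP sq' qz.
  have [_ _ xz] := adm x z qx qz.
  have := dist_to_lip x z bG; rewrite -/(d x) -/(d z) in xz * => h.
  rewrite mulrAC ler_pdivrMr// (mulrC _ A); apply: le_trans Az.
  have h1 : (1 - tau) * (K * l q) <= (1 - tau) * d x by rewrite ler_pM2l// subr_gt0.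
  by rewrite -mulrA; lra.
have eta0 : 0 < (1 - tau) * K / A by rewrite divr_gt0// mulr_gt0// subr_gt0.
rewrite -[leLHS]powRr1// -(mulfV (lt0r_neq0 p0)) powRrM /edge_bound.
rewrite ge0_ler_powR ?nnegrE ?invr_ge0 ?(ltW p0) ?powR_ge0//.
  apply: mulr_ge0; last exact/fine_ge0/cube_energy_ge0.
  by apply: mulr_ge0; [exact: edge_const_ge0|exact: powR_ge0].
have ln0 : 0 < l q ^+ n by rewrite exprn_gt0.
apply: le_trans (_ : (k * l q' ^+ n * l q ^+ n)^-1 * fine (cube_energy q) <= _).
  rewrite mulrC ler_pdivlMr ?mulr_gt0 ?exprn_gt0// mulrC.
  by apply: le_trans est; rewrite mulrA.
apply: ler_wpM2r; first exact/fine_ge0/cube_energy_ge0.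
rewrite -[_ * l q `^ _](invrK) lef_pV2 ?posrE; last 2 first.
- by rewrite !mulr_gt0 ?exprn_gt0.
- by rewrite invr_gt0 mulr_gt0 ?powR_gt0// divr_gt0 ?powR_gt0 ?exprn_gt0.
apply: le_trans (_ : k * (((1 - tau) * K / A) * l q) ^+ n * l q ^+ n <= _); last first.
  rewrite ler_pM2r// ler_pM2l//; apply: lerXn2r => //; rewrite nnegrE ltW//.
  exact: mulr_gt0.
rewrite /k /edge_const powRM ?(ltW A0) ?(ltW (l0 q))// -/a [((1 - tau) * K / A * l q) ^+ n]exprMn.
rewrite le_eqVlt; apply/orP; left; apply/eqP.
have E1 : l q `^ (delta * p - n%:R) = l q `^ a / (l q ^+ n * l q ^+ n).
  rewrite -powR_mulrn ?(ltW (l0 q))// -powRD ?(gt_eqF (l0 q)) ?implybT// -powRB ?(gt_eqF (l0 q)) ?implybT//.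
  by congr powR; rewrite /a; ring.
have := exprn_gt0 n eta0; have := powR_gt0 a (l0 q); have := powR_gt0 a A0.
rewrite E1; set X := (_ / A) ^+ n; set Y := l q `^ a; set Z := A `^ a.
by move=> Z0 Y0 X0; field; rewrite !gt_eqF.
Qed.

Lemma average_edge q q' : sel q -> sel q' -> whitney_adm G tau q q' ->
  (cube_energy q < +oo)%E -> `|av q - av q'| <= edge_bound q.
Proof.
move=> sq sq' adm Eoo; apply: le_trans (oscillation_edge sq sq' adm Eoo).
rewrite distrC; apply: le_trans (dist_average_le (mcube q) (mu_cube0 q) (mu_cubeoo q) (vint_cube q) _) _.
by rewrite mu_cube/=; under eq_Rintegral do rewrite distrC.
Qed.

(** Lets [oscillation_edge] also bound the oscillation on a cube about its own average. *)
Lemma whitney_adm_refl q : sel q -> whitney_adm G tau q q.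
Proof.
move=> sq; apply/asboolP => x y qx qy.
have [Gx _ Kx _] := selP sq qx; have [Gy _ _ _] := selP sq qy; split => //.
apply: le_lt_trans (dyadic_cube_diam qx qy) _.
have -> : n%:R * dyadic_side R q.1 = tau / 16 * (K * l q).
  by rewrite /K /l; field; rewrite gt_eqF.
have dx : 0 < d x by exact: dist_boundary_gt0.
apply: le_lt_trans (_ : tau / 16 * d x < _); first by rewrite ler_pM2l// divr_gt0.
by rewrite -/(d x) ltr_pM2r// ltr_pdivrMr// ltr_pMr// ltr1n.
Qed.

Lemma average_path q s : path (whitney_adm G tau) q s ->
  (forall r, r \in q :: s -> sel r /\ (cube_energy r < +oo)%E) ->
  `|av q - av (last q s)| <= \sum_(r <- q :: s) edge_bound r.
Proof.
elim: s q => [|q' s ih] q /=.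
  by move=> _ _; rewrite subrr normr0 big_seq1 powR_ge0.
move=> /andP[qq' ps] sE; rewrite big_cons -(subrKA (av q')).
apply: le_trans (ler_normD _ _) _; apply: lerD.
  have [sq Eq] := sE q (mem_head _ _).
  by apply: average_edge => //; have [] := sE q'; rewrite // !inE eqxx orbT.
by apply: ih => // r rs; apply: sE; rewrite inE rs orbT.
Qed.

(** The triangle inequality through the average on [q] gives two terms, each bounded by the chain
    sum. *)
Lemma chain_estimate q s : path (whitney_adm G tau) q s ->
  (forall r, r \in q :: s -> sel r /\ (cube_energy r < +oo)%E) ->
  \int[mu]_(x in cube q) `|v x - av (last q s)| <=
    2 * (l q ^+ n * \sum_(r <- q :: s) edge_bound r).
Proof.
move=> ps sE; set a := av (last q s); have [sq Eq] := sE q (mem_head _ _).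
have ln0 : 0 < l q ^+ n by rewrite exprn_gt0.
have intd t : mu.-integrable (cube q) (EFin \o (fun x => `|v x - t|)).
  have := integrable_dist (mcube q) (mu_cubeoo q) (vint_cube q) t.
  by apply: eq_integrable => // x _ /=; rewrite distrC.
have := intd a.
have intc := integrable_cst_on (mcube q) (mu_cubeoo q) `|av q - a|.
have -> : 2 * (l q ^+ n * \sum_(r <- q :: s) edge_bound r) =
    l q ^+ n * \sum_(r <- q :: s) edge_bound r +
    l q ^+ n * \sum_(r <- q :: s) edge_bound r.
  by ring.
move=> inta.
apply: le_trans (_ : \int[mu]_(x in cube q) (`|v x - av q| + `|av q - a|) <= _).
  apply: le_Rintegral => //.
    have := integrableD (mcube q) (intd (av q)) intc; exact: eq_integrable.
  by move=> x _; rewrite -(subrKA (av q) (v x)) ler_normD.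
rewrite RintegralD// Rintegral_cst// mu_cube/=; apply: lerD; last first.
  by rewrite mulrC ler_pM2l// average_path.
rewrite -ler_pdivrMl// mulrC; apply: le_trans (oscillation_edge sq sq (whitney_adm_refl sq) Eq) _.
by rewrite big_cons lerDl sumr_ge0// => r _; exact: powR_ge0.
Qed.

End whitney_poincare.

(** * Disjointness of Whitney cubes in finite families *)

Section finite_families.
Variables (R : realType) (n : nat) (mu : {measure set (rVb R n) -> \bar R}).
Hypothesis mu_iint : forall f : rVb R n -> \bar R, measurable_fun setT f ->
  (forall x, 0 <= f x)%E -> iint f = (\int[mu]_x f x)%E.
Variables (G : set 'rV[R]_n) (wq : 'rV[R]_n -> nat * 'rV[int]_n) (S : seq (nat * 'rV[int]_n)).
Hypothesis wqE : forall x, G x -> forall y, dyadic_cube (wq x) y -> G y /\ wq y = wq x.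
Hypotheses (uS : uniq S) (selS : forall q, q \in S -> exists2 z, G z & q = wq z).

(** Distinct selected cubes are disjoint, [wq] being constant on each, so at most one term is
    nonzero. *)
Lemma sum_indic_cubes (Z : set 'rV[R]_n) x (w : \bar R) : (0 <= w)%E ->
  (forall q, q \in S -> dyadic_cube q `<=` Z) ->
  (\sum_(q <- S) (\1_(dyadic_cube q) x)%:E * w <= (\1_Z x)%:E * w)%E.
Proof.
move=> w0 SZ.
have [/hasP[q0 q0S xq0]|/hasPn nx] := boolP (has (fun q => x \in dyadic_cube q) S).
  rewrite (bigD1_seq q0)//= [X in (_ + X)%E]big1_seq ?adde0.
    by rewrite !indicE xq0 mem_set//; exact/(SZ q0)/set_mem.
  move=> q /andP[qq0 qS]; rewrite indicE memNset ?mul0e// => xq.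
  have [z Gz E1] := selS qS; have [z0 Gz0 E2] := selS q0S.
  move/set_mem : xq0; rewrite E2 => xq0; rewrite E1 in xq.
  move/eqP : qq0; apply; rewrite E1 E2.
  by rewrite -(wqE Gz xq).2 (wqE Gz0 xq0).2.
rewrite big1_seq ?mule_ge0// ?lee_fin// => q /andP[_ qS].
by rewrite indicE (negbTE (nx q qS)) mul0e.
Qed.

Lemma sum_side_le_vol (Z : set 'rV[R]_n) : (forall q, q \in S -> dyadic_cube q `<=` Z) ->
  ((\sum_(q <- S) dyadic_side R q.1 ^+ n)%:E <= vol Z)%E.
Proof.
move=> SZ; rewrite -sumEFin.
rewrite (eq_bigr (fun q => iint (fun x : 'rV[R]_n => (\1_(dyadic_cube q) x)%:E))); last first.
  move=> q _; rewrite -(mu_dyadic_cube mu_iint) -(vol_measurable mu_iint)//.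
  exact: measurable_rVbox.
apply: le_trans (le_iint_sum _ _) _; first by move=> q x; rewrite lee_fin.
apply: le_iint => x; first by apply: sume_ge0 => q _; rewrite lee_fin.
have := @sum_indic_cubes Z x 1%E lee01 SZ.
by rewrite mule1; under eq_bigr do rewrite mule1.
Qed.

Lemma sum_energy_le (K : 'rV[R]_n -> \bar R) : (forall x, 0 <= K x)%E ->
  (\sum_(q <- S) iint (fun x : 'rV[R]_n => (\1_(dyadic_cube q) x)%:E * K x) <=
   iint (fun x => (\1_G x)%:E * K x))%E.
Proof.
move=> K0; apply: le_trans (le_iint_sum _ _) _.
  by move=> q x; rewrite mule_ge0// lee_fin.
apply: le_iint => x; first by apply: sume_ge0 => q _; rewrite mule_ge0// lee_fin.
apply: sum_indic_cubes => // q qS y qy; have [z Gz E1] := selS qS.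
by rewrite E1 in qy; have [] := wqE Gz qy.
Qed.
End finite_families.

Section finite_sum_bound.
Variables (R : realType) (n : nat) (mu : {measure set (rVb R n) -> \bar R}).
Hypothesis mu_iint : forall f : rVb R n -> \bar R, measurable_fun setT f ->
  (forall x, 0 <= f x)%E -> iint f = (\int[mu]_x f x)%E.
Variables (G : set 'rV[R]_n) (wq : 'rV[R]_n -> nat * 'rV[int]_n) (x0 : 'rV[R]_n).
Variables (chain : nat * 'rV[int]_n -> seq (nat * 'rV[int]_n)).
Variables (s p delta lam tau A B C4 M2 : R).
Hypotheses (n0 : (0 < n)%N) (s1 : 1 <= s) (p1 : 1 < p) (delta0 : 0 < delta).
Hypotheses (tau0 : 0 < tau) (tau1 : tau < 1) (A0 : 0 < A) (B0 : 0 < B) (C40 : 0 <= C4).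
Hypotheses (bG : boundary G !=set0) (oG : open G).
Hypothesis wqP : forall x, G x -> [/\ dyadic_cube (wq x) x,
     forall y, dyadic_cube (wq x) y -> G y /\ wq y = wq x,
     16 * n%:R / tau * dyadic_side R (wq x).1 <= dist_to x (boundary G) &
     dist_to x (boundary G) <= A * dyadic_side R (wq x).1].
Hypothesis chainP : forall x, G x ->
   [/\ path (whitney_adm G tau) (wq x) (chain (wq x)), last (wq x) (chain (wq x)) = wq x0,
     uniq (wq x :: chain (wq x)),
     forall r, r \in wq x :: chain (wq x) -> exists z, [/\ G z, r = wq z &
       forall y, dyadic_cube (wq x) y -> enorm (y - z) <= B * shadow_radius s r.1 /\
         dist_to y (boundary G) <= B * shadow_radius s r.1] &
     forall j, (count (fun r => r.1 == j) (wq x :: chain (wq x)))%:R * dyadic_side R j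
       <= B * shadow_radius s j].
Hypothesis minkowski : forall h, 0 < h -> h <= 1 ->
  (vol (rneigh (boundary G) (2 * B * h)) <= (C4 * h `^ (n%:R - lam))%:E)%E.
Hypothesis M2P : forall J, \sum_(j < J)
    (edge_const n p delta tau A * dyadic_side R j `^ (delta * p - n%:R) * 
     shadow_radius s j ^+ n) `^ (p - 1)^-1 *
    (B * C4 * (shadow_radius s j / dyadic_side R j * shadow_radius s j `^ (n%:R - lam))) <= M2.

Let h j := shadow_radius s j : R.
Let h0 j : 0 < h j. Proof. by rewrite powR_gt0// dyadic_side_gt0. Qed.
Let h1 j : h j <= 1.
Proof.
have -> : 1 = 1 `^ s^-1 :> R by rewrite powR1.
rewrite ge0_ler_powR ?nnegrE ?invr_ge0 ?dyadic_side_le1 ?(ltW (dyadic_side_gt0 _ _))//.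
exact: le_trans s1.
Qed.

Let wqE x (Gx : G x) : forall y, dyadic_cube (wq x) y -> G y /\ wq y = wq x.
Proof. by have [] := wqP Gx. Qed.

Section family.
Variable S : seq (nat * 'rV[int]_n).
Hypotheses (uS : uniq S) (selS : forall q, q \in S -> exists2 z, G z & q = wq z).

Let V (q : nat * 'rV[int]_n) := dyadic_side R q.1 ^+ n.

(** The point of [r] supplied by [chainP] varies with [q]. Passing to one fixed point [w0] of [r]
    costs a diameter of [r], so all these [q] lie in one ball of radius [(B + n) * h]. *)
Lemma shadow_bound r : \sum_(q <- S | r \in q :: chain q) V q
   <= (4 * (B + n%:R)) ^+ n * h r.1 ^+ n.
Proof.
have Bn : 0 < B + n%:R by rewrite addr_gt0// ltr0n.
rewrite -big_filter; set S' := [seq _ <- _ | _].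
have [->|] := eqVneq S' [::].
  by rewrite big_nil ltW// mulr_gt0// exprn_gt0// mulr_gt0.
rewrite -has_filter => /hasP[q0 q0S rq0].
have sel q : q \in S' -> exists x, [/\ G x, q = wq x & r \in wq x :: chain (wq x)].
  rewrite mem_filter => /andP[rq qS]; have [x Gx E1] := selS qS.
  by exists x; rewrite -E1.
have [w0 [Gw0 rw0]] : exists w0, G w0 /\ r = wq w0.
  have q0S' : q0 \in S' by rewrite mem_filter rq0.
  have [x [Gx E1 rx]] := sel q0 q0S'.
  by have [_ _ _ /(_ r rx)[z [Gz rz _]] _] := chainP Gx; exists z.
rewrite -exprMn -mulrA -lee_fin.
pose Z : set 'rV[R]_n := [set y | enorm (y - w0) <= (B + n%:R) * h r.1].
apply: le_trans (_ : vol Z <= _)%E; last first.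
  by apply: (@vol_bounded_le _ _ _ w0) => //; rewrite mulr_gt0.
apply: (sum_side_le_vol mu_iint wqE).
- by rewrite filter_uniq.
- by move=> q /sel[x [Gx qx _]]; exists x.
move=> q /sel[x [Gx -> rx]] y qy; rewrite /Z/=.
have [_ _ _ /(_ r rx)[z [Gz rz zP]] _] := chainP Gx.
have [yz _] := zP y qy; apply: le_trans (enorm_triangle _ z _) _.
rewrite mulrDl; apply: lerD => //.
have zr : dyadic_cube r z by rewrite rz; have [] := wqP Gz.
have wr : dyadic_cube r w0 by rewrite rw0; have [] := wqP Gw0.
apply: le_trans (dyadic_cube_diam zr wr) _.
by rewrite ler_wpM2l// le_shadow_radius.
Qed.

(** Each chain has at most B h / 2^-j cubes of level [j], and starting cubes with any lie within B h
    of the boundary; the radius 2 B h makes this strict, as [rneigh] demands. *)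
Lemma level_bound j :
  \sum_(q <- S) V q * (count (fun r : nat * 'rV[int]_n => r.1 == j) (q :: chain q))%:R <=
  B * C4 * (h j / dyadic_side R j * h j `^ (n%:R - lam)).
Proof.
have l0 := dyadic_side_gt0 R j.
pose P (q : nat * 'rV[int]_n) := has (fun r : nat * 'rV[int]_n => r.1 == j) (q :: chain q).
rewrite (bigID P) [X in _ + X <= _]big1 ?addr0; last first.
  by move=> q; rewrite /P has_count -eqn0Ngt => /eqP ->; rewrite mulr0.
apply: le_trans (_ : \sum_(q <- S | P q) V q * (B * h j / dyadic_side R j) <= _).
  rewrite big_seq_cond [leRHS]big_seq_cond; apply: ler_sum => q /andP[qS _].
  rewrite ler_wpM2l ?exprn_ge0 ?(ltW (dyadic_side_gt0 _ _))// ler_pdivlMr//.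
  by have [x Gx ->] := selS qS; have [_ _ _ _] := chainP Gx; exact.
rewrite -mulr_suml.
have -> : B * C4 * (h j / dyadic_side R j * h j `^ (n%:R - lam)) =
  C4 * h j `^ (n%:R - lam) * (B * h j / dyadic_side R j) by ring.
rewrite ler_wpM2r; [by []|by rewrite divr_ge0 ?mulr_ge0 ?(ltW B0) ?(ltW (h0 j)) ?(ltW l0)|].
rewrite -lee_fin; apply: le_trans (minkowski (h0 j) (h1 j)).
rewrite -big_filter; apply: (sum_side_le_vol mu_iint wqE).
- by rewrite filter_uniq.
- by move=> q; rewrite mem_filter => /andP[_]; exact: selS.
move=> q; rewrite mem_filter => /andP[/hasP[r rq /eqP rj] qS] y.
have [x Gx E1] := selS qS; rewrite E1 in rq * => qy.
have [_ _ _ /(_ r rq)[z [Gz _ zP]] _] := chainP Gx.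
have [_ dy] := zP y qy; apply: dist_to_lt => //.
apply: le_lt_trans dy _; rewrite rj -/(h j) -mulrA ltr_pMl ?mulr_gt0//.
by rewrite ltr1n.
Qed.

Variable (N : set (rVb R n)) (u v : rVb R n -> R).
Hypotheses (mN : measurable N) (N0 : mu N = 0%E) (mv : measurable_fun setT v).
Hypothesis vint : mu.-integrable setT (EFin \o v).
Hypothesis vu : forall x, G x -> ~ N x -> v x = u x.
Variable E0 : R.
Let K := inner_energy G p delta tau u.
Hypothesis E0P : iint (fun x => (\1_G x)%:E * K x)%E = E0%:E.

Lemma finite_sum_bound :
  \sum_(q <- S) \int[mu]_(x in dyadic_cube q) `|v x - average mu (dyadic_cube (wq x0)) v| <=
    2 * (((4 * (B + n%:R)) ^+ n + M2) * E0 `^ p^-1).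
Proof.
have p0 : 0 < p by exact: lt_trans p1.
have Eq q : (exists2 z, G z & q = wq z) -> (cube_energy G p delta tau u q <= E0%:E)%E.
  move=> [z Gz ->]; rewrite -E0P; apply: le_iint => x.
    by rewrite mule_ge0 ?inner_energy_ge0// lee_fin.
  rewrite lee_wpmul2r ?inner_energy_ge0// lee_fin !indicE.
  case: (boolP (x \in dyadic_cube (wq z))) => [/set_mem xq|_]; last exact: ler0n.
  rewrite mem_set//.
  by have [] := wqE Gz xq.
have Eoo q : (exists2 z, G z & q = wq z) -> (cube_energy G p delta tau u q < +oo)%E.
  by move=> /Eq/le_lt_trans; apply; exact: ltry.
have E00 : 0 <= E0.
  by rewrite -lee_fin -E0P; apply: iint_ge0 => x; rewrite mule_ge0 ?inner_energy_ge0// lee_fin.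
have selC q r : q \in S -> r \in q :: chain q -> exists2 z, G z & r = wq z.
  move=> qS; have [x Gx ->] := selS qS => rx.
  by have [_ _ _ /(_ r rx)[z [Gz rz _]] _] := chainP Gx; exists z.
apply: le_trans (_ : \sum_(q <- S) 2 * (V q * \sum_(r <- q :: chain q)
    edge_bound G p delta tau A u r) <= _).
  rewrite big_seq [leRHS]big_seq; apply: ler_sum => q qS.
  have sC := selC q ^~ qS; have [x Gx E1] := selS qS.
  have [pth lst _ _ _] := chainP Gx; rewrite -E1 in pth lst.
  rewrite -lst; apply: (chain_estimate mu_iint n0 p1 delta0 tau0 tau1 A0 bG oG wqP mN N0 mv vint vu pth).
  by move=> r rq; split; [exact: sC|exact/Eoo/sC].
rewrite -mulr_sumr ler_pM2l//.
(* Young's inequality divides by [E0], so zero energy is treated apart: then every edge bound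
   vanishes. *)
have [E0E|E0E] := eqVneq E0 0.
  rewrite [leLHS]big1_seq => [|q /andP[_ qS]].
    rewrite E0E powR0 ?mulr0// invr_eq0; exact: lt0r_neq0.
  rewrite big1_seq ?mulr0// => r /andP[_ rq].
  have := Eq r (selC q r qS rq); rewrite E0E => Er.
  have -> : edge_bound G p delta tau A u r = 0.
    rewrite /edge_bound; have -> : cube_energy G p delta tau u r = 0%E.
      by apply/eqP; rewrite eq_le Er cube_energy_ge0.
    by rewrite mulr0 powR0// invr_eq0; exact: lt0r_neq0.
  by [].
apply: (@chain_sum R _ fst S (fun q => q :: chain q) V (fun r => fine (cube_energy G p delta tau u r))
   p E0 _ M2 (fun j => edge_const n p delta tau A * dyadic_side R j `^ (delta * p - n%:R))
   (fun j => h j ^+ n) (fun j => B * C4 * (h j / dyadic_side R j * h j `^ (n%:R - lam)))) => //.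
- by rewrite lt_neqAle eq_sym E0E.
- by rewrite exprn_ge0// mulr_ge0// addr_ge0// ltW.
- by move=> q; rewrite exprn_ge0// ltW// dyadic_side_gt0.
- by move=> r; exact/fine_ge0/cube_energy_ge0.
- by move=> j; rewrite mulr_ge0 ?powR_ge0//; exact: edge_const_ge0.
- by move=> j; rewrite exprn_gt0.
- by move=> q qS; have [x Gx ->] := selS qS; have [] := chainP Gx.
- exact: shadow_bound.
- exact: level_bound.
move=> T uT sT; have selT r : r \in T -> exists2 z, G z & r = wq z.
  by move=> /sT/flatten_mapP[q qS rq]; exact: selC qS rq.
rewrite -lee_fin -E0P -sumEFin big_seq (eq_bigr (cube_energy G p delta tau u)).
  rewrite -big_seq; apply: (sum_energy_le wqE uT selT) => x; exact: inner_energy_ge0.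
move=> r rT; rewrite fineK// ge0_fin_numE ?cube_energy_ge0//.
exact/Eoo/selT.
Qed.
End family.
End finite_sum_bound.

(** * From finite families of cubes to the whole domain *)

Section countable_union.
Variables (R : realType) (n : nat) (mu : {measure set (rVb R n) -> \bar R}).
Variables (G : set 'rV[R]_n) (wq : 'rV[R]_n -> nat * 'rV[int]_n).
Hypothesis wqP : forall x, G x ->
  dyadic_cube (wq x) x /\ forall y, dyadic_cube (wq x) y -> G y /\ wq y = wq x.

Lemma integral_cubes_le (f : rVb R n -> R) (M : R) :
  measurable_fun setT f -> (forall x, 0 <= f x) ->
  (forall q, mu.-integrable (dyadic_cube q : set (rVb R n)) (EFin \o f)) ->
  (forall S, uniq S -> (forall q, q \in S -> exists2 z, G z & q = wq z) ->
    \sum_(q <- S) \int[mu]_(x in dyadic_cube q) f x <= M) ->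
  (\int[mu]_(x in G) (f x)%:E <= M%:E)%E.
Proof.
move=> mf f0 intf HM; pose I := (nat * 'rV[int]_n)%type.
pose sel (q : I) := `[< exists2 z, G z & q = wq z >].
(* [pickle_inv] is injective where it is defined, so no cube is listed twice and the sequence is
   disjoint; the remaining indices get the empty set. *)
pose F k : set (rVb R n) :=
  oapp (fun q : I => if sel q then dyadic_cube q else set0) set0 (pickle_inv k).
have mcube (q : I) : measurable (dyadic_cube q : set (rVb R n)) by exact: measurable_rVbox.
have mF k : measurable (F k).
  by rewrite /F; case: pickle_inv => //= q; case: ifP.
have GE : G = \bigcup_k F k.
  apply/seteqP; split=> [x Gx|x [k _]].
    have [qx _] := wqP Gx; have [k kx] : exists k, F k x.
      exists (pickle (wq x)); rewrite /F pickleK_inv/=.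
      by rewrite (_ : sel _ = true)//; apply/asboolP; exists x.
    by exists k.
  rewrite /F; case: pickle_inv => //= q; case: ifP => // /asboolP[z Gz ->] qx.
  by have [_ /(_ x qx)[]] := wqP Gz.
have tF : trivIset [set: nat] F.
  apply/trivIsetP => i j _ _ ij; apply/seteqP; split => // x [].
  rewrite /F.
  case E1 : (pickle_inv i) => [q|]//=; case E2 : (pickle_inv j) => [q'|]//=.
  case: ifP => // /asboolP[z Gz qz]; case: ifP => // /asboolP[z' Gz' qz'] qx qx'.
  move/eqP : ij; apply.
  have qq' : q = q'.
    rewrite qz in qx *; rewrite qz' in qx' *.
    by have [_ /(_ x qx)[_ <-]] := wqP Gz; have [_ /(_ x qx')[_ <-]] := wqP Gz'.
  have := @pickle_invK I i; have := @pickle_invK I j.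
  by rewrite E1 E2 /= qq' => <- <-.
rewrite GE ge0_integral_bigcup//; last 2 first.
- by apply: measurable_funTS; exact/measurable_EFinP.
- by move=> x _; rewrite lee_fin.
apply: lime_le.
  by apply: is_cvg_nneseries => k _ _; apply: integral_ge0 => x _; rewrite lee_fin.
apply: nearW => m.
pose g (q : I) := \int[mu]_(x in dyadic_cube q) f x.
have gE (q : I) : (\int[mu]_(x in dyadic_cube q) (f x)%:E = (g q)%:E)%E.
  by rewrite /g /Rintegral fineK//; exact: integrable_fin_num (intf q).
pose S := [seq q <- pmap (@pickle_inv I) (index_iota 0 m) | sel q].
rewrite (_ : (\sum_(0 <= k < m) _)%E = (\sum_(q <- S) g q)%:E); last first.
  rewrite /S; elim: (index_iota 0 m) => [|k ks ih]; first by rewrite !big_nil.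
  rewrite big_cons ih {1}/F /=; case: pickle_inv => [q|]/=; last first.
    by rewrite integral_set0 add0e.
  case: ifP => _; last by rewrite integral_set0 add0e.
  by rewrite big_cons EFinD gE.
rewrite lee_fin; apply: HM.
  by rewrite filter_uniq// (pmap_uniq (@pickle_invK I))// iota_uniq.
by move=> q; rewrite mem_filter => /andP[/asboolP].
Qed.
End countable_union.

(** * Integrability of the Borel version and passage to the mean *)

Section mean_values.
Variables (R : realType) (n : nat) (mu : {measure set (rVb R n) -> \bar R}).
Hypothesis mu_iint : forall f : rVb R n -> \bar R, measurable_fun setT f ->
  (forall x, 0 <= f x)%E -> iint f = (\int[mu]_x f x)%E.
Variables (G : set 'rV[R]_n) (N : set (rVb R n)) (u : rVb R n -> R) (p : R).
Hypotheses (mG : measurable (G : set (rVb R n))) (G0 : (0 < mu G)%E) (Goo : (mu G < +oo)%E).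
Hypotheses (mN : measurable N) (N0 : mu N = 0%E) (p1 : 1 < p).
Let v : rVb R n -> R := fun x => \1_(G `\` N) x * u x.
Hypothesis mv : measurable_fun setT v.

Let vE x : ~ N x -> \1_G x * u x = v x.
Proof. by move=> Nx; rewrite /v !indicE in_setD (memNset Nx) andbT. Qed.

Let v_out x : ~ G x -> v x = 0.
Proof. by move=> Gx; rewrite /v indicE memNset ?mul0r// => -[]. Qed.

(** On [G], |v| <= 1 + |v|^p, and [G] has finite measure. *)
Lemma borel_version_integrable :
  (iint (fun x => (\1_G x * (`|u x| `^ p))%:E) < +oo)%E -> mu.-integrable setT (EFin \o v).
Proof.
move=> Lp; have p0 : 0 < p by exact: lt_trans p1.
have mvp : measurable_fun setT (fun x => (`|v x| `^ p)%:E).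
  apply/measurable_EFinP; apply: (@measurableT_comp _ _ _ _ _ _ (@powR R ^~ p)) => //.
  exact: measurableT_comp.
have Ivp : (\int[mu]_x (`|v x| `^ p)%:E < +oo)%E.
  apply: le_lt_trans Lp; apply: (le_iint_ae mu_iint mN N0) => // x Nx.
   rewrite lee_fin -vE// indicE; case: (x \in G); rewrite ?mul1r//.
  by rewrite mul0r normr0 powR0 ?mul0r ?gt_eqF.
apply/integrableP; split; first exact/measurable_EFinP.
apply: le_lt_trans (_ : \int[mu]_x ((\1_G x)%:E + (`|v x| `^ p)%:E) < +oo)%E.
  apply: ge0_le_integral => //.
  - by apply/measurable_EFinP; exact: measurableT_comp.
  - apply: emeasurable_funD => //; apply/measurable_EFinP; exact: measurable_indic.
  move=> x _ /=; rewrite -EFinD lee_fin; have [Gx|nGx] := pselect (G x); last first.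
    by rewrite v_out// normr0 addr_ge0 ?powR_ge0.
  rewrite indicE mem_set//; have [v1|v1] := leP `|v x| 1.
    by apply: le_trans v1 _; rewrite lerDl powR_ge0.
  by apply: le_trans (le1r_powR (ltW v1) (ltW p1)) _; rewrite lerDr.
rewrite ge0_integralD//.
  by rewrite integral_indic// setIT lte_add_pinfty.
by apply/measurable_EFinP; exact: measurable_indic.
Qed.

Hypothesis vint : mu.-integrable setT (EFin \o v).

Lemma mean_average : mean G u = average mu G v.
Proof.
rewrite /mean /average (vol_measurable mu_iint mG); congr (_ / _).
have -> : \int[mu]_(x in G) v x = \int[mu]_x v x.
  rewrite Rintegral_mkcond; apply: eq_Rintegral => x _; rewrite patchE.
  by case: ifPn => // /negP nG; rewrite v_out// => Gx; apply: nG; exact: mem_set.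
rewrite /Rintegral integralE fineB; last 2 first.
- exact: integrable_pos_fin_num.
- exact: integrable_neg_fin_num.
rewrite /iintR; congr (fine _ - fine _).
  rewrite (iint_eq_ae mu_iint mN N0 (g := (EFin \o v)^\+%E)).
  - by [].
  - exact/measurable_funepos/measurable_EFinP.
  - by move=> x; rewrite lee_fin le_max lexx orbT.
  - by move=> x; exact: funepos_ge0.
  by move=> x Nx; rewrite funeposE /= -EFin_max vE.
rewrite (iint_eq_ae mu_iint mN N0 (g := (EFin \o v)^\-%E)).
- by [].
- exact/measurable_funeneg/measurable_EFinP.
- by move=> x; rewrite lee_fin le_max lexx orbT.
- by move=> x; exact: funeneg_ge0.
by move=> x Nx; rewrite funenegE vE// EFin_max EFinN.
Qed.

(** The mean is itself within [M / |G|] of [a], so replacing [a] by it at most doubles the bound. *)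
Lemma mean_deviation_le (a M : R) :
  (\int[mu]_(x in G) (`|v x - a|)%:E <= M%:E)%E ->
  (iint (fun x => (\1_G x * `|u x - mean G u|)%:E) <= (2 * M)%:E)%E.
Proof.
move=> aM; set b := mean G u.
have vintG : mu.-integrable G (EFin \o v) by exact: integrableS vint.
have intd t : mu.-integrable G (EFin \o (fun x => `|v x - t|)).
  have := integrable_dist mG Goo vintG t.
  by apply: eq_integrable => // x _ /=; rewrite distrC.
have IM : \int[mu]_(x in G) `|v x - a| <= M.
  by rewrite -lee_fin /Rintegral fineK//; exact: integrable_fin_num (intd a).
have intc := integrable_cst_on mG Goo `|a - b|.
have mdist t : measurable_fun setT (fun x => `|v x - t|).
  by apply: measurableT_comp => //; exact: measurable_funB.
apply: le_trans (_ : \int[mu]_(x in G) (`|v x - b|)%:E <= _)%E.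
  rewrite integral_mkcond; apply: (iint_le_ae mu_iint mN N0).
  - apply: (measurable_restrictT _ mG).1; apply: measurable_funTS.
    exact/measurable_EFinP.
  - by move=> x; rewrite lee_fin mulr_ge0.
  - by apply: erestrict_ge0 => x _; rewrite lee_fin.
  move=> x Nx; rewrite patchE indicE -vE//; case: ifPn => [xG|_]; last by rewrite mul0r.
  by rewrite indicE xG !mul1r.
have -> : (\int[mu]_(x in G) (`|v x - b|)%:E)%E = (\int[mu]_(x in G) `|v x - b|)%:E.
  by rewrite /Rintegral fineK//; exact: integrable_fin_num (intd b).
rewrite lee_fin; apply: le_trans (_ : \int[mu]_(x in G) (`|v x - a| + `|a - b|) <= _).
  apply: le_Rintegral => //.
    by have := integrableD mG (intd a) intc; exact: eq_integrable.
  by move=> x _; rewrite -(subrKA a (v x)) ler_normD.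
rewrite RintegralD// Rintegral_cst//.
have m0 : 0 < fine (mu G) by rewrite fine_gt0// G0.
have := dist_average_le mG G0 Goo vintG a; rewrite -mean_average -/b ler_pdivlMr//.
by under eq_Rintegral do rewrite distrC; move=> h; lra.
Qed.
End mean_values.

(* If the boundary were empty, [dist_to] would be [inf set0 = 0], contradicting the
   John condition at the end of any nontrivial curve. *)
Lemma john_boundary_nonempty (R : realType) (n : nat) (s c : R) (x0 : 'rV[R]_n)
    (G : set 'rV[R]_n) : (0 < n)%N -> open G -> 0 < c -> G x0 ->
  (forall x, G x -> exists (l : R) (g : R -> 'rV[R]_n),
      [/\ 0 <= l /\ l <= c, g 0 = x, g l = x0, arclength_param g l &
        forall t, 0 <= t -> t <= l ->
          G (g t) /\ t `^ s / c <= dist_to (g t) (boundary G)]) ->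
  boundary G !=set0.
Proof.
move=> n0 oG c0 Gx0 john; apply/set0P/eqP => bG.
have /nbhs_ballP[e /= e0 eG] := open_nbhs_nbhs (conj oG Gx0).
pose x := x0 + const_mx (e / 2).
have Gx : G x.
  apply: eG; split => // i j; rewrite /ball/= !mxE opprD addNKr normrN gtr0_norm ?divr_gt0//.
  by rewrite ltr_pdivrMr// ltr_pMr// ltr1n.
have [l [g [[l0 _] g0 gl _ gP]]] := john x Gx.
have : 0 < l.
  rewrite lt_neqAle l0 andbT; apply/eqP => l00; move: gl; rewrite -l00 g0 => /rowP.
  move=> /(_ (Ordinal n0)); rewrite !mxE => /eqP.
  by rewrite -subr_eq0 addrAC subrr add0r gt_eqF// divr_gt0.
have [_] := gP l l0 (lexx l); rewrite bG /dist_to image_set0 inf0 => h lgt0.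
by move: h; rewrite leNgt divr_gt0 ?powR_gt0.
Qed.

Theorem theorem5p1 (R : realType) (n : nat) (s p lam delta tau : R)
    (G : set 'rV[R]_n) :
  (2 <= n)%N -> 1 < s -> 1 < p ->
  (n.-1)%:R <= lam -> lam < n%:R ->
  0 < delta -> delta < 1 -> 0 < tau -> tau < 1 ->
  s < (n%:R + 1 - lam) / (1 - delta) ->
  (s * (n%:R - 1) - lam + 1) / (n%:R - s * (1 - delta) - lam + 1) < p ->
  john_domain s G -> (dimM (boundary G) <= lam%:E)%E ->
  exists c : R, forall u : 'rV[R]_n -> R, Lp p G u ->
    (iint (fun x => (\1_G x * `|u x - mean G u|)%:E)
     <= c%:E *
        (iint (fun x => (\1_G x)%:E *
            iint (fun y =>
              (\1_(G `&` eball x (tau * dist_to x (boundary G))) y *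
               (`|u x - u y| `^ p / enorm (x - y) `^ (n%:R + delta * p)))%:E))
         `^ (p^-1)))%E.
Proof.
move=> n2 s1 p1 lamn lamn' delta0 delta1 tau0 tau1 hs hp.
move=> [[oG cG _] [Mb GMb] [x0 [c [Gx0 c0 john]]]] dimG.
have n0 : (0 < n)%N by exact: ltn_trans n2.
have p0 : 0 < p by exact: lt_trans p1.
have [lam' [ll ln' den0 hp']] := perturb_exponent s1 delta0 delta1 lamn' hs hp p1.
have bG := john_boundary_nonempty n0 oG c0 Gx0 john.
have [e Ee] := bG.
have dD x : G x -> dist_to x (boundary G) <= Mb + enorm e.
  move=> Gx; apply: le_trans (dist_to_le _ Ee) _.
  by apply: le_trans (enormD _ _) _; rewrite enormN lerD2r GMb.
have [wq [A [B [chain [A0 B0 wqP chainP]]]]] :=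
  john_chains n0 oG bG dD (ltW s1) tau0 tau1 c0 Gx0 john.
have lam'0 : 0 <= lam' by rewrite ltW// (le_lt_trans _ ll)// (le_trans _ lamn).
have B20 : 0 < 2 * B by rewrite mulr_gt0.
have [C4 [C40 mink]] := minkowski_bound GMb lam'0 ll ln' dimG B20.
have [mu mu_iint] := iint_measureP R n.
have ec0 : 0 <= edge_const n p delta tau A by exact: edge_const_ge0.
have [M2 M2P] := shadow_sum s1 p1 ec0 (mulr_ge0 (ltW B0) C40) den0 hp'.
have M20 : 0 <= M2 by have := M2P 0%N; rewrite big_ord0.
pose M1 := (4 * (B + n%:R)) ^+ n.
have M10 : 0 < M1 by rewrite exprn_gt0// mulr_gt0// addr_gt0// ltr0n.
(* The outer 2 comes from [mean_deviation_le], the inner one from [chain_estimate]. *)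
exists (2 * (2 * (M1 + M2))) => u [mu_u Lpu].
set E := iint (fun x => _ * iint _)%E.
have E0 : (0 <= E)%E.
  by apply: iint_ge0 => x; rewrite mule_ge0 ?inner_energy_ge0// lee_fin.
(* With infinite energy the right-hand side is infinite, the constant being positive. *)
have [->|Eoo] := eqVneq E +oo%E.
  rewrite poweRyr ?invr_eq0 ?gt_eqF// gt0_muley ?leey// lte_fin.
  by rewrite !mulr_gt0// ltr_wpDr.
have EE : E = (fine E)%:E by rewrite fineK// ge0_fin_numE// ltey.
have [N [mN N0 mv]] := borel_version mu_iint oG mu_u.
set v := (fun x => _) in mv.
have mG : measurable (G : set (rVb R n)) by exact: open_rVb_measurable.
have G0 : (0 < mu G)%E.
  apply: lt_le_trans (_ : mu (dyadic_cube (wq x0)) <= _)%E.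
    by rewrite (mu_dyadic_cube mu_iint) lte_fin exprn_gt0// dyadic_side_gt0.
  apply: le_measure; rewrite ?inE//; first exact: measurable_rVbox.
  by move=> x; have [_ wx _ _] := wqP _ Gx0; move=> /wx[].
have Goo : (mu G < +oo)%E.
  rewrite -(vol_measurable mu_iint mG); apply: le_lt_trans (ltry ((4 * (`|Mb| + 1)) ^+ n)).
  apply: (@vol_bounded_le _ _ _ 0); first by rewrite ltr_wpDl.
  move=> y Gy; rewrite subr0; apply: le_trans (GMb y Gy) _.
  by have := ler_norm Mb; lra.
have vint : mu.-integrable setT (EFin \o v) by exact: borel_version_integrable Lpu.
have vu x : G x -> ~ N x -> v x = u x.
  by move=> Gx Nx; rewrite /v indicE mem_set ?mul1r.
rewrite EE poweR_EFin -EFinM -!mulrA.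
pose a0 := average mu (dyadic_cube (wq x0)) v.
apply: (mean_deviation_le mu_iint mG G0 Goo mN N0 mv vint (a := a0)).
apply: (@integral_cubes_le R n mu G wq).
- by move=> x Gx; have [] := wqP x Gx.
- by apply: measurableT_comp => //; exact: measurable_funB.
- by [].
- move=> q; have mq : measurable (dyadic_cube q : set (rVb R n)) by exact: measurable_rVbox.
  have qoo : (mu (dyadic_cube q) < +oo)%E by rewrite (mu_dyadic_cube mu_iint) ltry.
  have := integrable_dist mq qoo (integrableS measurableT mq (@subsetT _ _) vint) a0.
  by apply: eq_integrable => // x _ /=; rewrite distrC.
move=> S uS selS.
exact: (finite_sum_bound mu_iint n0 (ltW s1) p1 delta0 tau0 tau1 A0 B0 bG oG wqP
  chainP mink M2P uS selS mN N0 mv vint vu EE).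
Qed.
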